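(* Let $\lambda\in(1,2]$ and $\tau_0\in(0,(\lambda-1)^2]$. For each $d$, let $W,u,M,b$ be as in the context and define $$\mathtt{ovlap}_{d,\lambda}(\tau_0):=\mathbb{E}_{M,b}\Big[\max_{\widehat u\in\mathcal S^{d-1}}\mathbb{E}_u\big[\langle\widehat u,u\rangle^2\mid M,b\big]\Big].$$ Then $$\limsup_{d\to\infty}\mathtt{ovlap}_{d,\lambda}(\tau_0)\le 1-\frac{1}{\lambda^2}+\tau_0+\frac{\sqrt{\tau_0}}{\lambda}.$$
   Context: $W$ is a $d\times d$ symmetric random matrix with independent entries $W_{ii}\sim\mathcal N(0,2/d)$, $W_{ij}\sim\mathcal N(0,1/d)$ for $i<j$; $u\sim\mathcal N(0,I_d/d)$ independent of $W$; $M=\lambda uu^\top+W$; $b=\sqrt{\tau_0}\,u+z$ with $z\sim\mathcal N(0,I_d/d)$ independent of $(W,u)$. $\mathcal S^{d-1}$ is the unit sphere in $\mathbb{R}^d$. *)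

(* Defs.v *)
From HB Require Import structures.
From mathcomp Require Import all_boot all_order all_algebra.
From mathcomp Require Import all_classical all_reals all_analysis.
Set Implicit Arguments. Unset Strict Implicit. Unset Printing Implicit Defensive.
Import Order.TTheory GRing.Theory Num.Theory.
Import numFieldNormedType.Exports.
Local Open Scope classical_set_scope.
Local Open Scope ring_scope.

Section gaussian.
Variable R : realType.

Fixpoint gauss_iter (I : eqType) (s : seq I) (f : (I -> R) -> \bar R)
    (v : I -> R) : \bar R :=
  match s with
  | [::] => f v
  | i :: s' => (\int[normal_prob 0 1]_x
                 gauss_iter s' f (fun j => if j == i then x else v j))%E
  end.

Definition gauss_exp (I : finType) (f : (I -> R) -> \bar R) : \bar R :=
  gauss_iter (enum I) f (fun _ => 0).

Definition sqnorm d (x : 'I_d -> R) : R := \sum_i x i ^+ 2.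
Definition dotp d (x y : 'I_d -> R) : R := \sum_i x i * y i.
Definition unit_sphere d : set ('I_d -> R) := [set x | sqnorm x = 1].
Arguments unit_sphere : clear implicits.

(* Likelihood of (M,b) given the spike u (up to a factor independent of u):
   M = lam u u^T + W, W ~ GOE (density prop. to exp(-(d/4)||W||_F^2)),
   b = sqrt(tau0) u + z, z ~ N(0, I/d). *)
Definition lik (lam tau0 : R) d (M : 'I_d -> 'I_d -> R) (b u : 'I_d -> R) : R :=
  expR (- (d%:R / 4) * (\sum_i \sum_j (M i j - lam * u i * u j) ^+ 2)
        - (d%:R / 2) * (\sum_i (b i - Num.sqrt tau0 * u i) ^+ 2)).

(* Posterior expectation E_u[<uh,u>^2 | M, b] by Bayes' formula,
   the prior u ~ N(0, I/d) being realized as u = g / sqrt d, g standard. *)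
Definition post_overlap (lam tau0 : R) d (M : 'I_d -> 'I_d -> R)
    (b uh : 'I_d -> R) : R :=
  let u g := fun i => g i / Num.sqrt d%:R in
  fine (gauss_exp (fun g : 'I_d -> R => ((dotp uh (u g)) ^+ 2 * lik lam tau0 M b (u g))%:E))
  / fine (gauss_exp (fun g : 'I_d -> R => (lik lam tau0 M b (u g))%:E)).

Definition best_overlap (lam tau0 : R) d (M : 'I_d -> 'I_d -> R) (b : 'I_d -> R) : R :=
  sup [set post_overlap lam tau0 M b uh | uh in unit_sphere d].

(* ovlap_{d,lam}(tau0) = E_{M,b}[ max_{uh in S^{d-1}} E[<uh,u>^2 | M,b] ].
   The randomness is realized by i.i.d. standard Gaussians:
   G (d x d), g, h (d-vectors) with W = (G + G^T)/sqrt(2d)  (so that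
   W_ii ~ N(0,2/d), W_ij ~ N(0,1/d) for i<j, all independent),
   u = g/sqrt d, z = h/sqrt d. *)
Definition ovlap (lam tau0 : R) (d : nat) : \bar R :=
  gauss_exp (fun x : ('I_d * 'I_d + 'I_d + 'I_d)%type -> R =>
    let G i j := x (inl (inl (i, j))) in
    let u i := x (inl (inr i)) / Num.sqrt d%:R in
    let z i := x (inr i) / Num.sqrt d%:R in
    let W i j := (G i j + G j i) / Num.sqrt (2 * d%:R) in
    let M i j := lam * u i * u j + W i j in
    let b i := Num.sqrt tau0 * u i + z i in
    (best_overlap lam tau0 M b)%:E).

End gaussian.

(* Main.v *)
(* Given (M, b), the overlap is the top eigenvalue of the posterior second-moment
   matrix of u. Add an independent observation k = sqrt(delta d) u + N(0, I) and,
   for a unit vector v, compare the new posterior mean of u with the estimator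
   v (v.k) / sqrt(delta d): by optimality of the posterior mean,
     E[<v,u>^2 | M, b] <= E[|E[u | M, b, k]|^2 | M, b] + 1 / (d delta),
   and the right-hand side no longer depends on v. So the overlap is at most
   q + 1 / (d delta), where q = E|E[u | M, b, k]|^2 is the mean-square overlap
   with side information of strength tau = tau0 + delta. Gaussian integration by
   parts in u, applied to E[u_i E[u_i | M, b, k]], and the concentration of |u|^2
   give, for all 0 < eta <= 1,
     q <= tau (1 - q) + lam^2 (q - (1 - eta) q^2 + 1 / (2 eta d)).
   The limiting inequality lam^2 q^2 - (lam^2 - 1 - tau0) q - tau0 <= 0 fails with
   a margin at q = 1 - 1/lam^2 + sqrt(tau0)/lam, so q stays below this value for
   large d and small delta, eta; the term tau0 of the bound absorbs
   1 / (d delta). *)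

Require Import Defs.
From HB Require Import structures.
From mathcomp Require Import all_boot all_order all_algebra.
From mathcomp Require Import all_classical all_reals all_analysis.
From mathcomp Require Import measurable_realfun ring lra.
Set Implicit Arguments. Unset Strict Implicit. Unset Printing Implicit Defensive.
Import Order.TTheory GRing.Theory Num.Theory.
Import numFieldNormedType.Exports.
Local Open Scope classical_set_scope.
Local Open Scope ring_scope.

(** * One-dimensional Gaussian integrals *)

(** The computations use [w = sqrt d u], observed through a channel with unit Gaussian noise. Every
    posterior is written as a density against pure noise (Cameron-Martin), so that Bayes' formula
    becomes an identity between integrals over product spaces and no conditional law has to be
    constructed. The inequality for q comes from an exact identity. When one coordinate of [w] moves
    and the noise is frozen, the observation follows a curve, along which the derivative of a
    posterior mean is a posterior covariance. After summation over the coordinates, the tower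
    property puts the true signal back in place of posterior averages. With [S] the scalar product
    of [w] and its posterior mean, the matrix part becomes a multiple of [E[|w|^2 S] - E[S^2]].
    Jensen bounds [E[S^2]] from below by the square of [E[S]], the overlap itself. As [|w|^2] and
    [S] are correlated, a fraction [eta] of [S^2] is given up to decouple them, whence the factor
    [1 - eta]. *)

Lemma integral_cst_probability d (T : measurableType d) (R : realType)
  (P : probability T R) (k : \bar R) : (\int[P]_x k = k)%E.
Proof.
rewrite integral_cst// [X in (_ * X)%E](_ : _ = 1%E) ?mule1//.
exact: probability_setT.
Qed.

(* [lebesgue_measure] and [normal_prob 0 1] live on [measurableTypeR R], whose
   display differs from the one of [R]; [leb] and [gauss] are their copies on [R]. *)
Section copies.
Variable R : realType.

Definition leb : set R -> \bar R := @lebesgue_measure R.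
Let leb0 : leb set0 = 0%E. Proof. exact: measure0. Qed.
Let leb_ge0 A : (0 <= leb A)%E. Proof. exact: measure_ge0. Qed.
Let leb_sigma_additive : semi_sigma_additive leb.
Proof. exact: (@measure_semi_sigma_additive _ _ _ (@lebesgue_measure R)). Qed.
HB.instance Definition _ := isMeasure.Build _ _ _
  leb leb0 leb_ge0 leb_sigma_additive.
Let leb_sigma_finite : sigma_finite setT leb.
Proof. exact: (@sigma_finiteT _ _ _ (@lebesgue_measure R)). Qed.
HB.instance Definition _ := @Measure_isSigmaFinite.Build _ _ _ leb leb_sigma_finite.

Definition gauss : set R -> \bar R := normal_prob (0 : R) 1.
Let gauss0 : gauss set0 = 0%E. Proof. exact: measure0. Qed.
Let gauss_ge0 A : (0 <= gauss A)%E. Proof. exact: measure_ge0. Qed.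
Let gauss_sigma_additive : semi_sigma_additive gauss.
Proof. exact: (@measure_semi_sigma_additive _ _ _ (normal_prob (0 : R) 1)). Qed.
HB.instance Definition _ := isMeasure.Build _ _ _
  gauss gauss0 gauss_ge0 gauss_sigma_additive.
Let gauss_setT : gauss setT = 1%E. Proof. exact: probability_setT. Qed.
HB.instance Definition _ := @Measure_isProbability.Build _ _ R gauss gauss_setT.

(** The identity is measurable between the two structures, so the integral is transported by a
    pushforward along it. *)
Lemma ge0_integral_measurableTypeR (m : {measure set (measurableTypeR R) -> \bar R})
    (m' : {measure set R -> \bar R}) (A : set R) (f : R -> \bar R) :
  m = m' :> (set R -> \bar R) -> measurable A ->
  measurable_fun [set: R] f -> (forall x, (0 <= f x)%E) ->
  (\int[m]_(x in A) f x = \int[m']_(x in A) f x)%E.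
Proof.
move=> mm' mA mf f0.
have mid : measurable_fun setT (id : measurableTypeR R -> R).
  exact: (@measurable_id _ R setT).
transitivity (\int[pushforward m (id : measurableTypeR R -> R)]_(x in A) f x)%E.
  rewrite [RHS]ge0_integral_pushforward//; exact: measurable_funTS.
by apply: (@eq_measure_integral _ R R A m') => B mB _ /=; rewrite -mm'.
Qed.

Lemma integral_measurableTypeR (m : {measure set (measurableTypeR R) -> \bar R})
    (m' : {measure set R -> \bar R}) (A : set R) (f : R -> \bar R) :
  m = m' :> (set R -> \bar R) -> measurable A -> measurable_fun [set: R] f ->
  (\int[m]_(x in A) f x = \int[m']_(x in A) f x)%E.
Proof.
move=> mm' mA mf; rewrite integralE [RHS]integralE.
by congr (_ - _)%E; apply: ge0_integral_measurableTypeR => //;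
  [exact: measurable_funepos|exact: measurable_funeneg].
Qed.

End copies.

Section gauss1.
Variable R : realType.
Notation mu := (@leb R).
Notation gam := (@gauss R).
Notation pdf := (@normal_pdf R 0 1).

Lemma measurable_pdf : measurable_fun [set: R] pdf.
Proof. exact: (@measurable_normal_pdf R 0 1). Qed.

Lemma gaussE (A : set R) : measurable A -> gam A = (\int[mu]_(x in A) (pdf x)%:E)%E.
Proof.
move=> mA; rewrite -(@ge0_integral_measurableTypeR _ (@lebesgue_measure R))//.
- by apply/measurable_EFinP; exact: measurable_pdf.
- by move=> x; rewrite lee_fin normal_pdf_ge0.
Qed.

Lemma ge0_integral_gauss (f : R -> \bar R) :
  measurable_fun [set: R] f -> (forall x, (0 <= f x)%E) ->
  (\int[gam]_x f x = \int[mu]_x (f x * (pdf x)%:E))%E.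
Proof.
move=> mf f0.
have mp : measurable_fun [set: R] (fun x => (pdf x)%:E).
  by apply/measurable_EFinP; exact: measurable_pdf.
have dom : gam `<< mu by exact: (@normal_prob_dominates R 0 1).
rewrite -(Radon_Nikodym_SigmaFinite.change_of_variables dom)//=.
(* The Radon-Nikodym derivative is determined only almost everywhere; it agrees there with [pdf]
   because both have the same integral over every measurable set. *)
apply: ae_eq_integral => //.
- apply: emeasurable_funM => //; apply: (measurable_int mu).
  exact: Radon_Nikodym_SigmaFinite.f_integrable.
- exact: emeasurable_funM.
- apply: ae_eqe_mul2l => /=.
  apply: integral_ae_eq => //=.
  + exact: Radon_Nikodym_SigmaFinite.f_integrable.
  + move=> E E01 mE; rewrite -gaussE//.
    exact/esym/Radon_Nikodym_SigmaFinite.f_integral.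
Qed.

Lemma lebDr (a : R) (A : set R) : measurable A ->
  pushforward mu ((fun x => x + a) : _ -> R) A = mu A.
Proof.
move=> mA; change (pushforward lebesgue_measure
  ((fun x => x + a) : _ -> measurableTypeR R) A = lebesgue_measure A).
apply/esym/lebesgue_measure_unique => //=.
  exact: (@measurable_funD _ R R setT id (cst a)).
move=> mf _ [[b c]] _ <-.
rewrite /pushforward /=.
have -> : (fun x : R => x + a) @^-1` `]b, c] = `]b - a, c - a]%classic.
  by apply/seteqP; split=> x /=; rewrite !in_itv/= ltrBlDr lerBrDr.
rewrite [RHS]lebesgue_measure_itv [LHS]lebesgue_measure_itv/= !lte_fin ltrD2r.
by rewrite -!EFinB opprB addrA subrK.
Qed.

Lemma ge0_integral_lebDr (a : R) (f : R -> \bar R) :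
  measurable_fun [set: R] f -> (forall x, (0 <= f x)%E) ->
  (\int[mu]_x f (x + a)%R = \int[mu]_x f x)%E.
Proof.
move=> mf f0.
have mt : measurable_fun setT (fun x : R => x + a) by exact: measurable_funD.
transitivity (\int[pushforward mu (fun x : R => (x + a)%R)]_x f x)%E.
  by rewrite ge0_integral_pushforward//=.
by apply: eq_measure_integral => A mA _; exact: lebDr.
Qed.

Lemma normal01_pdfE (x : R) : pdf x = pdf 0 * expR (- x ^+ 2 / 2).
Proof.
rewrite !normal_pdfE ?oner_eq0// /normal_fun !subr0 expr0n/= oppr0 mul0r expR0 mulr1.
by rewrite expr1n.
Qed.

Lemma normal01_pdfB (x a : R) : pdf (x - a) = pdf x * expR (a * x - a ^+ 2 / 2).
Proof.
rewrite normal01_pdfE (normal01_pdfE x) -mulrA -expRD; congr (_ * expR _).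
by field.
Qed.

(** One-dimensional Cameron-Martin formula: translation invariance of [leb] moves the shift onto the
    density, and [normal01_pdfB] gives the ratio of the two densities. *)
Lemma ge0_integral_gauss_shift (a : R) (f : R -> \bar R) :
  measurable_fun [set: R] f -> (forall x, (0 <= f x)%E) ->
  (\int[gam]_x f (x + a)%R = \int[gam]_x (f x * (expR (a * x - a ^+ 2 / 2))%:E))%E.
Proof.
move=> mf f0.
have ma : measurable_fun setT (fun x : R => x + a) by exact: measurable_funD.
have me : measurable_fun setT (fun x : R => expR (a * x - a ^+ 2 / 2)).
  by apply: measurableT_comp => //; apply: measurable_funB => //; exact: measurable_funM.
rewrite !ge0_integral_gauss//; last 3 first.
- apply: emeasurable_funM => //; exact/measurable_EFinP.
- by move=> x; rewrite mule_ge0// lee_fin expR_ge0.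
- exact: measurableT_comp.
rewrite -(@ge0_integral_lebDr a (fun x => f x * (expR (a * x - a ^+ 2 / 2))%:E * (pdf x)%:E)%E).
- apply: eq_integral => x _; rewrite -muleA; congr (_ * _)%E.
  rewrite -EFinM mulrC; congr _%:E.
  by rewrite -normal01_pdfB addrK.
- apply: emeasurable_funM; last by apply/measurable_EFinP; exact: measurable_pdf.
  by apply: emeasurable_funM => //; exact/measurable_EFinP.
- by move=> x; rewrite !mule_ge0// lee_fin ?expR_ge0// normal_pdf_ge0.
Qed.

Lemma integral_gauss_expR (a : R) :
  (\int[gam]_x (expR (a * x))%:E = (expR (a ^+ 2 / 2))%:E)%E.
Proof.
have k0 : (0 <= (expR (a ^+ 2 / 2))%:E)%E by rewrite lee_fin expR_ge0.
rewrite -[RHS](integral_cst_probability gam).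
(* A constant function is invariant under the shift, and this constant cancels the normalisation
   [- a ^+ 2 / 2] of the Cameron-Martin density. *)
rewrite (@ge0_integral_gauss_shift a (cst (expR (a ^+ 2 / 2))%:E))//.
by apply: eq_integral => x _; rewrite -EFinM -expRD addrC subrK.
Qed.

Lemma integral_gauss_expR_norm (c : R) :
  (\int[gam]_x (expR (c * `|x|))%:E < +oo)%E.
Proof.
have me (b : R) : measurable_fun setT (fun x : R => (expR (b * x))%:E).
  by apply/measurable_EFinP; apply: measurableT_comp => //; exact: measurable_funM.
apply: (@le_lt_trans _ _ (\int[gam]_x ((expR (c * x))%:E + (expR (- c * x))%:E))%E).
  apply: ge0_le_integral => //.
  - apply/measurable_EFinP; apply: measurableT_comp => //.
    by apply: measurable_funM => //; exact: measurableT_comp.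
  - exact: emeasurable_funD.
  - move=> x _; rewrite -EFinD lee_fin.
    case: (ger0P (x : R)) => x0; first by rewrite lerDl expR_ge0.
    by rewrite mulrN mulNr lerDr expR_ge0.
rewrite ge0_integralD//.
by rewrite !integral_gauss_expR -EFinD ltry.
Qed.

Lemma integrable_gauss (f : R -> R) :
  gam.-integrable setT (EFin \o f) ->
  mu.-integrable setT (EFin \o (fun x => f x * pdf x)).
Proof.
move=> /integrableP[mf fi]; have {}mf : measurable_fun setT f by exact/measurable_EFinP.
apply/integrableP; split.
  apply/measurable_EFinP; apply: measurable_funM => //; exact: measurable_pdf.
rewrite (_ : integral _ _ _ = (\int[gam]_x `|(EFin \o f) x|)%E)//.
rewrite ge0_integral_gauss//; last by do 2 apply: measurableT_comp => //.
by apply: eq_integral => x _ /=; rewrite normrM EFinM (ger0_norm (normal_pdf_ge0 _ _ _)).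
Qed.

Lemma integral_gauss (f : R -> R) : measurable_fun [set: R] f ->
  (\int[gam]_x (f x)%:E = \int[mu]_x (f x * pdf x)%:E)%E.
Proof.
move=> mf; have mef : measurable_fun [set: R] (EFin \o f) by exact/measurable_EFinP.
rewrite integralE [RHS]integralE !ge0_integral_gauss//.
- congr (_ - _)%E; apply: eq_integral => x _; have p0 := @normal_pdf_ge0 R 0 1 x.
  + by rewrite !funeposE -!EFin_max -EFinM maxr_pMl// mul0r.
  + by rewrite !funenegE -!EFinN -!EFin_max -EFinM maxr_pMl// mul0r mulNr.
- exact: (measurable_funeneg mef).
- exact: (measurable_funepos mef).
Qed.

(** Otherwise [|F|] would exceed [e] on a set of infinite measure. This supplies endpoints of
    integration at which [F] is small, in place of a limit of [F] at infinity. *)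
Lemma integrable_exists_small (F : R -> R) (A : set R) (e : R) :
  measurable A -> mu A = +oo%E -> mu.-integrable A (EFin \o F) -> 0 < e ->
  exists2 y, A y & `|F y| <= e.
Proof.
move=> mA Aoo /integrableP[mF Fi] e0; apply/not_exists2P => H.
suff : (+oo <= \int[mu]_(x in A) `|(EFin \o F) x|)%E by rewrite leNgt Fi.
rewrite (_ : +oo%E = (\int[mu]_(x in A) (cst e%:E x))%E); last first.
  by rewrite integral_cst//= [X in (_ * X)%E]Aoo gt0_muley// lte_fin.
apply: ge0_le_integral => //.
- by move=> x _; rewrite lee_fin ltW.
- exact: measurableT_comp.
- move=> x Ax; rewrite lee_fin; case: (H x) => [//|/negP].
  by rewrite -ltNge => /ltW.
Qed.

(** On [[x, y]] the integral is [F y - F x]. Integrability of [f] controls the tails, and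
    integrability of [F] provides endpoints with small boundary terms. *)
Lemma integral_derive_eq0 (F f : R -> R) :
  (forall x : R, is_derive x (1:R) F (f x)) -> continuous f ->
  mu.-integrable setT (EFin \o F) -> mu.-integrable setT (EFin \o f) ->
  (\int[mu]_x (f x)%:E = 0)%E.
Proof.
move=> dF cf iF jf.
have mf : measurable_fun setT f by exact: continuous_measurable_fun.
have If : (\int[mu]_x (f x)%:E \is a fin_num)%E by exact: integrable_fin_num jf.
set I := fine (\int[mu]_x (f x)%:E)%E.
suff I0 : I = 0 by rewrite -(fineK If) -/I I0.
have Fcont : continuous F.
  by move=> x; apply: differentiable_continuous; apply/derivable1_diffP; case: (dF x).
have ftc (a b : R) : a < b -> (\int[mu]_(x in `[a, b]) (f x)%:E = (F b - F a)%:E)%E.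
  move=> ab; rewrite -(@integral_measurableTypeR _ (@lebesgue_measure R))//; last exact/measurable_EFinP.
  rewrite (@continuous_FTC2 _ f F)//.
  - exact: continuous_subspaceT.
  - split => [x _||]; first by case: (dF x).
    + by apply: cvg_at_right_filter; exact: Fcont.
    + by apply: cvg_at_left_filter; exact: Fcont.
  - by move=> x _; rewrite derive1E; have [_ ->] := dF x.
apply/eqP; rewrite -normr_le0; apply/ler_addgt0Pr => e e0; rewrite add0r.
(* One third for the tails of [f] and one third for each of the two boundary values of [F]. *)
have e3 : 0 < e / 3 by rewrite divr_gt0.
have /integrableP[_ jf'] := jf.
pose g x := `|(f x)%:E|%E.
have mg : measurable_fun setT g by do 2 apply: measurableT_comp => //.
have g0 z : (0 <= g z)%E by exact: abse_ge0.
pose A (n : nat) : set R := `[- n%:R, n%:R]%classic.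
have AT : \bigcup_n A n = setT.
  apply/seteqP; split => // x _; exists (Num.bound `|x|) => //.
  by rewrite /A/= in_itv/= -ler_norml ltW//; exact: archi_boundP.
have mA n : measurable (A n) by exact: measurable_itv.
have gcvg : (\int[mu]_(x in A i) g x @[i --> \oo] --> \int[mu]_(x in \bigcup_i A i) g x)%E.
  apply: ge0_nondecreasing_set_cvg_integral => //.
  - move=> m n mn; rewrite subsetEset => z; rewrite /A/= !in_itv/= -!ler_norml.
    by move=> zm; rewrite (le_trans zm)// ler_nat.
  - by move=> n; exact: measurable_funTS.
rewrite AT in gcvg.
have Ig : (\int[mu]_x g x \is a fin_num)%E.
  by rewrite ge0_fin_numE//; apply: integral_ge0 => z _; exact: abse_ge0.
have Agfin n : (\int[mu]_(x in A n) g x \is a fin_num)%E.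
  rewrite ge0_fin_numE; last by apply: integral_ge0 => z _; exact: abse_ge0.
  apply: le_lt_trans jf'; apply: ge0_subset_integral => //.
have [n ng] : exists n, (\int[mu]_x g x - \int[mu]_(x in A n) g x < (e / 3)%:E)%E.
  rewrite -(fineK Ig) in gcvg *; move/fine_cvgP: gcvg => [_ gcvg].
    have gsub' : fine (\int[mu]_x g x) - e / 3 < fine (\int[mu]_x g x)%E by lra.
  have [n _ /(_ n (leqnn n)) /= ng] := @cvgr_gt _ _ _ _ _ _ gcvg _ gsub'.
  exists n; rewrite -(fineK (Agfin n)) -EFinB lte_fin; lra.
have close (x y : R) : x <= - n%:R -> n%:R <= y -> x < y -> `|I - (F y - F x)| <= e / 3.
  move=> xn ny xy.
  have mxy : measurable (`[x, y]%classic : set R) by exact: measurable_itv.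
  have dec : (\int[mu]_z (f z)%:E = \int[mu]_(z in `[x, y]) (f z)%:E +
      \int[mu]_(z in ~` `[x, y]%classic) (f z)%:E)%E.
    rewrite -[X in integral _ X _](setUv `[x, y]%classic) integral_setU//.
    - exact: measurableC.
    - by rewrite setUv; exact/measurable_EFinP.
    - exact/disj_setPCl.
  have decg : (\int[mu]_z g z = \int[mu]_(z in A n) g z +
      \int[mu]_(z in ~` A n) g z)%E.
    rewrite -[X in integral _ X _](setUv (A n)) ge0_integral_setU//.
    - exact: measurableC.
    - by rewrite setUv.
    - exact/disj_setPCl.
  have jc : mu.-integrable (~` `[x, y]%classic) (EFin \o f).
    apply: (integrableS measurableT) => //; exact: measurableC.
  have If' : (\int[mu]_z (f z)%:E)%E = I%:E by rewrite fineK.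
  have If'' : (\int[mu]_(z in ~` `[x, y]%classic) (f z)%:E)%E = (I - (F y - F x))%:E.
    have cfin : (\int[mu]_(z in ~` `[x, y]%classic) (f z)%:E)%E \is a fin_num.
      by apply: integrable_fin_num => //; exact: measurableC.
    move: dec; rewrite -(fineK cfin) If' ftc// -EFinD => -[h].
    by apply: congr1; rewrite h; ring.
  suff : (`|\int[mu]_(z in ~` `[x, y]%classic) (f z)%:E| <= (e / 3)%:E)%E.
    by rewrite If'' abse_EFin lee_fin.
  apply: (@le_trans _ _ (\int[mu]_(z in ~` `[x, y]%classic) g z)%E).
    apply: le_abse_integral => //; first exact: measurableC.
    exact: (measurable_int mu jc).
  apply: (@le_trans _ _ (\int[mu]_(z in ~` A n) g z)%E).
    apply: ge0_subset_integral => //.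
    - exact: measurableC.
    - exact: measurableC.
    - exact: measurable_funTS.
    - apply: subsetC => z; rewrite /A /= !in_itv/= => /andP[z1 z2].
      by rewrite (le_trans xn z1) (le_trans z2 ny).
  apply: ltW; apply: le_lt_trans ng; by rewrite decg addeAC subee ?add0e// Agfin.
(* The added 1 keeps [x < y] when [n] is 0. *)
have [y /= yn Fy] : exists2 y, `[n%:R + 1, +oo[%classic y & `|F y| <= e / 3.
  apply: (@integrable_exists_small F `[n%:R + 1, +oo[%classic) => //.
  - by rewrite [LHS]lebesgue_measure_itv/= ltry.
  - by apply: (integrableS measurableT).
have [x /= xn Fx] : exists2 x, `]-oo, - n%:R]%classic x & `|F x| <= e / 3.
  apply: (@integrable_exists_small F `]-oo, - n%:R]%classic) => //.
  - by rewrite [LHS]lebesgue_measure_itv/= ltNyr.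
  - by apply: (integrableS measurableT).
rewrite in_itv/= andbT in yn; rewrite in_itv/= in xn.
have n0 : 0 <= n%:R :> R by [].
have xy : x < y by lra.
have := close _ _ xn _ xy => /(_ _).
have ny : n%:R <= y by lra.
move=> /(_ ny); move: Fx Fy; rewrite !ler_norml => /andP[a1 a2] /andP[b1 b2] /andP[c1 c2].
by apply/andP; split; lra.
Qed.

Lemma is_derive_pdf (x : R) : is_derive x (1:R) pdf (- x * pdf x).
Proof.
have -> : pdf = (fun x => pdf 0 * expR (- x ^+ 2 / 2)) by apply/funext => y; exact: normal01_pdfE.
have h : is_derive x (1:R) (fun y : R => - y ^+ 2 / 2) (- x).
  by apply: is_derive_eq; rewrite /GRing.scale/=; field.
have h2 := @is_derive1_comp _ _ _ x _ _ (is_derive_expR _) h.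
have h3 : is_derive x (1:R) (fun y : R => pdf 0 *: expR (- y ^+ 2 / 2))
      (pdf 0 *: (expR (- x ^+ 2 / 2) * - x)).
  exact: is_deriveZ.
rewrite (_ : - x * _ = pdf 0 *: (expR (- x ^+ 2 / 2) * - x))//.
by rewrite /GRing.scale/=; ring.
Qed.

(** The derivative of [F * pdf] is [(f x - x * F x) * pdf x], and its integral vanishes. *)
Lemma gauss_stein (F f : R -> R) :
  (forall x : R, is_derive x (1:R) F (f x)) -> continuous f ->
  gam.-integrable setT (EFin \o F) -> gam.-integrable setT (EFin \o f) ->
  gam.-integrable setT (EFin \o (fun x => x * F x)) ->
  (\int[gam]_x (x * F x)%:E = \int[gam]_x (f x)%:E)%E.
Proof.
move=> dF cf iF jf ixF.
have mf : measurable_fun setT f by exact: continuous_measurable_fun.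
have cF : continuous F.
  by move=> x; apply: differentiable_continuous; apply/derivable1_diffP; case: (dF x).
have mF : measurable_fun setT F by exact: continuous_measurable_fun.
have mxF : measurable_fun setT (fun x : R => x * F x) by exact: measurable_funM.
have cp : continuous pdf by apply: continuous_normal_pdf; exact: oner_neq0.
have i1 := integrable_gauss jf; have i2 := integrable_gauss ixF.
have : (\int[mu]_x (f x * pdf x - x * F x * pdf x)%:E = 0)%E.
  apply: (@integral_derive_eq0 (fun x => F x * pdf x)).
  - move=> x; have hp := is_derive_pdf x; have hF := dF x.
    by apply: is_derive_eq; rewrite /GRing.scale/=; ring.
  - move=> x; apply: cvgB; first by apply: cvgM; [exact: cf|exact: cp].
    by apply: cvgM; [apply: cvgM; [exact: cvg_id|exact: cF]|exact: cp].
  - exact: integrable_gauss.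
  - exact: (integrableB _ i1 i2).
under eq_integral do rewrite EFinB.
rewrite (integralB measurableT i1 i2) /= -(integral_gauss mf) -(integral_gauss mxF).
have k1 : (\int[gam]_x (f x)%:E)%E \is a fin_num by exact: integrable_fin_num jf.
have k2 : (\int[gam]_x (x * F x)%:E)%E \is a fin_num by exact: integrable_fin_num ixF.
rewrite -(fineK k1) -(fineK k2) -EFinB => -[] /eqP.
by rewrite subr_eq0 => /eqP ->.
Qed.

End gauss1.

(** * Product Gaussian measures *)

Section law_transfer.
Context d d' (T : measurableType d) (T' : measurableType d') (R : realType).
Variables (P : probability T R) (Q : probability T' R).

Definition has_law (X : T -> T') :=
  measurable_fun setT X /\ forall A, measurable A -> Q A = P (X @^-1` A).

Lemma has_law_ge0_integral X (f : T' -> \bar R) : has_law X ->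
  measurable_fun setT f -> (forall x, (0 <= f x)%E) ->
  (\int[Q]_y f y = \int[P]_x f (X x))%E.
Proof.
move=> [mX QX] mf f0.
transitivity (\int[pushforward P X]_y f y)%E; last by rewrite ge0_integral_pushforward.
by apply: eq_measure_integral => A mA _; exact: QX.
Qed.

Lemma has_law_integrable X (f : T' -> \bar R) : has_law X ->
  measurable_fun setT f ->
  Q.-integrable setT f <-> P.-integrable setT (f \o X).
Proof.
move=> lX mf; have [mX _] := lX.
have e : (\int[Q]_y `|f y| = \int[P]_x `|(f \o X) x|)%E.
  apply: (@has_law_ge0_integral X (abse \o f)) => //.
    by apply: measurableT_comp => //; exact: measurable_abse.
  by move=> y; exact: abse_ge0.
split=> /integrableP[_ h]; apply/integrableP; split=> //.
- exact: measurableT_comp.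
- by rewrite -e.
- by rewrite e.
Qed.

Lemma has_law_integral X (f : T' -> \bar R) : has_law X ->
  measurable_fun setT f ->
  (\int[Q]_y f y = \int[P]_x f (X x))%E.
Proof.
move=> lX mf; rewrite integralE [RHS]integralE.
congr (_ - _)%E; rewrite (has_law_ge0_integral lX)//.
- by apply: eq_integral => x _; rewrite !funeposE.
- exact: measurable_funepos.
- by apply: eq_integral => x _; rewrite !funenegE.
- exact: measurable_funeneg.
Qed.

Lemma has_lawI X : measurable_fun setT X ->
  (forall f : T' -> \bar R, measurable_fun setT f -> (forall x, (0 <= f x)%E) ->
    (\int[Q]_y f y = \int[P]_x f (X x))%E) -> has_law X.
Proof.
move=> mX h; split=> // A mA.
have := h (EFin \o \1_A) _ _; rewrite integral_indic// setIT => ->.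
- rewrite -[in RHS](setIT (X @^-1` A)) -integral_indic//.
  by rewrite -[X in measurable X]setTI; exact: mX.
- by apply/measurable_EFinP; exact: measurable_indic.
- by move=> x /=; rewrite lee_fin.
Qed.

End law_transfer.

(** These sets generate the product sigma-algebra, which makes [gsp] the product of copies of the
    line indexed by [I]. *)
Definition cylinders (I : Type) (R : realType) : set (set (I -> R)) :=
  [set A | exists i : I, exists2 B : set R, measurable B & A = (fun w => w i) @^-1` B].
Definition gsp (I : Type) (R : realType) := g_sigma_algebraType (@cylinders I R).
HB.instance Definition _ I R := Measurable.on (@gsp I R).

Section product_space.
Variables (I : Type) (R : realType).
Notation X := (gsp I R).

Lemma measurable_coord (i : I) : measurable_fun setT (fun w : X => w i : R).
Proof.
by move=> _ B mB; rewrite setTI; apply: sub_sigma_algebra; exists i; exists B.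
Qed.

Lemma measurable_gsp d (T : measurableType d) (f : T -> X) :
  (forall i, measurable_fun setT (fun t => f t i : R)) -> measurable_fun setT f.
Proof.
move=> h; apply: (@measurability _ _ _ _ setT f (@cylinders I R)) => //.
move=> _ [_ [i [B mB ->]] <-]; exact: h.
Qed.

Lemma measurable_gsp_comp d (T : measurableType d) (f : T -> X) (i : I) :
  measurable_fun setT f -> measurable_fun setT (fun t => f t i : R).
Proof. by move=> mf; exact: (measurableT_comp (measurable_coord i)). Qed.

End product_space.

Section gaussian_space.
Variables (I : eqType) (R : realType).
Notation X := (gsp I R).
Notation gam := (@gauss R).

Definition upd (w : I -> R) (i : I) (x : R) : I -> R :=
  fun j => if j == i then x else w j.

Lemma measurable_upd d (T : measurableType d) (f : T -> X) (g : T -> R) (i : I) :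
  measurable_fun setT f -> measurable_fun setT g ->
  measurable_fun setT (fun t => upd (f t) i (g t) : X).
Proof.
move=> mf mg; apply: measurable_gsp => j; rewrite /upd.
by case: eqP => _ //; exact: measurable_gsp_comp.
Qed.

Lemma measurable_upd_pair (i : I) :
  measurable_fun setT (fun p : X * R => upd p.1 i p.2 : X).
Proof. by apply: measurable_upd; [exact: measurable_fst|exact: measurable_snd]. Qed.

Definition upd_mfun (i : I) : {mfun (X * R)%type >-> X} :=
  mfun_Sub (mem_set (@measurable_upd_pair i)).

(* For [s] without repetitions, the coordinates in [s] are i.i.d. standard Gaussian
   and the other ones are 0. *)
Fixpoint gP (s : seq I) : probability X R :=
  match s with
  | [::] => [the probability X R of dirac ((fun=> 0) : X)]
  | i :: s' => distribution (gP s' \x gam)%E (upd_mfun i)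
  end.

Lemma measurable_integral_upd (f : X -> \bar R) i :
  measurable_fun setT f -> (forall x, (0 <= f x)%E) ->
  measurable_fun setT (fun w : X => \int[gam]_x f (upd w i x))%E.
Proof.
move=> mf f0.
apply: (measurable_fun_fubini_tonelli_F (fun p : X * R => f (upd p.1 i p.2))) => //.
exact: measurableT_comp mf (measurable_upd_pair i).
Qed.

Lemma ge0_integral_gP_cons i s (f : X -> \bar R) :
  measurable_fun setT f -> (forall x, (0 <= f x)%E) ->
  (\int[gP (i :: s)]_w f w = \int[gP s]_w \int[gam]_x f (upd w i x))%E.
Proof.
move=> mf f0 /=; rewrite ge0_integral_distribution//=.
rewrite (@fubini_tonelli1 _ _ _ _ _ _ _ (fun p : X * R => f (upd p.1 i p.2)))//.
exact: measurableT_comp mf (measurable_upd_pair i).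
Qed.

(** The point that the nested integral [gauss_iter s] reaches from the base point [v] once the
    coordinates in [s] have been drawn. *)
Definition override (s : seq I) (w v : I -> R) : I -> R :=
  fun j => if j \in s then w j else v j.

Lemma measurable_override d (T : measurableType d) (f g : T -> X) s :
  measurable_fun setT f -> measurable_fun setT g ->
  measurable_fun setT (fun t => override s (f t) (g t) : X).
Proof.
move=> mf mg; apply: measurable_gsp => j; rewrite /override.
by case: (j \in s); exact: measurable_gsp_comp.
Qed.

Lemma gauss_iterE s (f : X -> \bar R) (v : X) : uniq s ->
  measurable_fun setT f -> (forall x, (0 <= f x)%E) ->
  gauss_iter s f v = (\int[gP s]_w f (override s w v))%E.
Proof.
move=> us mf f0; elim: s us v => [_ v|i s IH /andP[ins us] v].
  rewrite integral_dirac//=; last first.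
    by apply: (measurableT_comp mf); apply: measurable_override;
      [exact: measurable_id|exact: measurable_cst].
  by rewrite diracT mul1e; congr f; apply/funext.
have m1 : measurable_fun setT (fun p : X * R => f (override s p.1 (upd v i p.2))).
  apply: (measurableT_comp mf); apply: measurable_override => //.
  exact: measurable_upd.
rewrite ge0_integral_gP_cons//; last first.
  by apply: (measurableT_comp mf); exact: measurable_override.
transitivity (\int[normal_prob 0 1]_x \int[gP s]_w f (override s w (upd v i x)))%E.
  by apply: eq_integral => x _; rewrite -IH.
rewrite (@ge0_integral_measurableTypeR _ _ gam)//; last 2 first.
- exact: (measurable_fun_fubini_tonelli_G (fun p : X * R => f (override s p.1 (upd v i p.2)))).
- by move=> x; exact: integral_ge0.
rewrite -(@fubini_tonelli _ _ _ _ _ _ _ (fun p : X * R => f (override s p.1 (upd v i p.2))))//.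
apply: eq_integral => w _; apply: eq_integral => x _; congr f; apply/funext => j.
rewrite /override /upd inE; have [->|ji] := eqVneq j i; last by [].
by rewrite (negbTE ins).
Qed.

(** Redrawing an independent coordinate does not change the law. This is how one coordinate is
    isolated without splitting the product space. *)
Lemma has_law_upd s j : j \in s ->
  has_law (gP s \x gam)%E (gP s) (fun p => upd p.1 j p.2).
Proof.
move=> js; apply: has_lawI; first exact: measurable_upd_pair.
move=> f mf f0.
rewrite (@fubini_tonelli1 _ _ _ _ _ _ _ (fun p : X * R => f (upd p.1 j p.2)))//; last first.
  exact: measurableT_comp mf (measurable_upd_pair j).
rewrite /fubini_F/=; elim: s js f mf f0 => [//|i s IH]; rewrite inE => js f mf f0.
have F0 w : (0 <= \int[gam]_x f (upd w j x))%E by exact: integral_ge0.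
rewrite !ge0_integral_gP_cons//; last exact: measurable_integral_upd.
have [ij|ij] := eqVneq j i.
  apply: eq_integral => w _; rewrite ij.
  rewrite -[LHS](integral_cst_probability gam); apply: eq_integral => y _.
  apply: eq_integral => x _; congr f; apply/funext => k; rewrite /upd.
  by case: eqP.
rewrite (negbTE ij) /= in js.
have mh : measurable_fun setT (fun w : X => \int[gam]_x f (upd w i x))%E.
  exact: measurable_integral_upd.
rewrite (IH js _ mh); last by move=> w; exact: integral_ge0.
apply: eq_integral => w _.
have m2 : measurable_fun setT (fun p : R * R => f (upd (upd w j p.1) i p.2)).
  by apply: (measurableT_comp mf); apply: measurable_upd => //; exact: measurable_upd.
rewrite (@fubini_tonelli _ _ _ _ _ _ _ (fun p : R * R => f (upd (upd w j p.1) i p.2)))//.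
apply: eq_integral => y _; apply: eq_integral => x _; congr f; apply/funext => k.
by rewrite /upd; have [->|//] := eqVneq k i; rewrite eq_sym (negbTE ij).
Qed.

(** The Cameron-Martin density of the law translated by [a] along the coordinates in [s]. *)
Definition tilt (s : seq I) (a w : I -> R) : R :=
  \prod_(i <- s) expR (a i * w i - a i ^+ 2 / 2).

Lemma measurable_tilt s (a : I -> R) : measurable_fun setT (tilt s a : X -> R).
Proof.
apply: measurable_prod => i _; apply: measurableT_comp => //.
apply: measurable_funB => //; apply: measurable_funM => //.
exact: measurable_coord.
Qed.

Lemma ge0_integral_gP_shift s (a : I -> R) (f : X -> \bar R) : uniq s ->
  measurable_fun setT f -> (forall x, (0 <= f x)%E) ->
  (\int[gP s]_w f (fun j => (w j + (if j \in s then a j else 0))%R) =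
   \int[gP s]_w (f w * (tilt s a w)%:E))%E.
Proof.
elim: s f => [|i s IH] f us mf f0.
  apply: eq_integral => w _; rewrite /tilt big_nil mule1; congr f.
  by apply/funext => j; rewrite addr0.
move: us => /andP[ins us].
have t0 s' w : (0 <= (tilt s' a w)%:E)%E.
  by rewrite lee_fin; apply: prodr_ge0 => k _; exact: expR_ge0.
have msh (s' : seq I) : measurable_fun setT
      (fun w : X => (fun j => (w j + (if j \in s' then a j else 0))%R) : X).
  by apply: measurable_gsp => j; apply: measurable_funD => //; exact: measurable_coord.
have mt s' : measurable_fun setT (fun w : X => (tilt s' a w)%:E).
  by apply/measurable_EFinP; exact: measurable_tilt.
rewrite !ge0_integral_gP_cons//; last 3 first.
- exact: emeasurable_funM.
- by move=> w; rewrite mule_ge0.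
- exact: (measurableT_comp mf (msh (i :: s))).
pose e (x : R) := (expR (a i * x - a i ^+ 2 / 2))%:E.
have e0 x : (0 <= e x)%E by rewrite lee_fin expR_ge0.
have me : measurable_fun setT (e : R -> \bar R).
  apply/measurable_EFinP; apply: measurableT_comp => //.
  by apply: measurable_funB => //; exact: measurable_funM.
pose h (w : X) := (\int[gam]_x (f (upd w i x) * e x))%E.
have mh : measurable_fun setT h.
  apply: (measurable_fun_fubini_tonelli_F (fun p : X * R => f (upd p.1 i p.2) * e p.2)%E) => //.
  - apply: emeasurable_funM; last exact: measurableT_comp.
    exact: measurableT_comp mf (measurable_upd_pair i).
  - by move=> p; rewrite mule_ge0.
have h0 w : (0 <= h w)%E by apply: integral_ge0 => x _; rewrite mule_ge0.
transitivity (\int[gP s]_w h (fun j => (w j + (if j \in s then a j else 0))%R))%E.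
  apply: eq_integral => w _.
  rewrite /h -(@ge0_integral_gauss_shift _ _ (fun x => f (upd _ i x)))//.
  - apply: eq_integral => x _; congr f; apply/funext => j.
    by rewrite /upd inE; have [->|//] := eqVneq j i.
  - by apply: (measurableT_comp mf); exact: measurable_upd.
rewrite IH//; apply: eq_integral => w _.
rewrite -ge0_integralZr//; last 2 first.
- apply: emeasurable_funM => //; apply: (measurableT_comp mf).
  exact: measurable_upd.
- by move=> x _; rewrite mule_ge0.
apply: eq_integral => x _; rewrite -muleA; congr (_ * _)%E.
rewrite /tilt big_cons EFinM /upd eqxx; congr (_ * _%:E)%E.
by apply: eq_big_seq => j js; case: eqP => // ji; rewrite ji (negbTE ins) in js.
Qed.

(** Exponential moments dominate all powers of the coordinates, hence give [moments_coord]. *)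
Lemma integral_gP_expR_norm s (c : R) : uniq s ->
  (\int[gP s]_w (expR (c * \sum_(i <- s) `|w i|))%:E < +oo)%E.
Proof.
have me s' : measurable_fun setT (fun w : X => (expR (c * \sum_(i <- s') `|w i|))%:E).
  apply/measurable_EFinP; apply: measurableT_comp => //; apply: measurable_funM => //.
  apply: measurable_sum => i; apply: measurableT_comp => //; exact: measurable_coord.
elim: s => [_|i s IH /andP[ins us]].
  under eq_integral do rewrite big_nil mulr0 expR0.
  by rewrite (integral_cst_probability (gP [::])) ltry.
rewrite ge0_integral_gP_cons//.
have mg : measurable_fun setT (fun x : R => (expR (c * `|x|))%:E).
  apply/measurable_EFinP; apply: measurableT_comp => //; apply: measurable_funM => //.
under eq_integral => w _.
  under eq_integral => x _.
    rewrite big_cons /upd eqxx mulrDr expRD EFinM.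
    rewrite (_ : \sum_(j <- s) _ = \sum_(j <- s) `|w j|); last first.
      by apply: eq_big_seq => j js; case: eqP => // ji; rewrite ji (negbTE ins) in js.
    over.
  rewrite ge0_integralZr//.
  over.
rewrite ge0_integralZl//; last by apply: integral_ge0 => x _; rewrite lee_fin expR_ge0.
rewrite lte_mul_pinfty//.
- by apply: integral_ge0 => x _; rewrite lee_fin expR_ge0.
- rewrite ge0_fin_numE; first exact: integral_gauss_expR_norm.
  by apply: integral_ge0 => x _; rewrite lee_fin expR_ge0.
- exact: IH.
Qed.

End gaussian_space.

(** * Functions with finite moments and Stein's identity *)

Section moments.
Context d (T : measurableType d) (R : realType) (mu : probability T R).
Implicit Types f g : T -> R.

(** Membership in every L^p with p finite. Unlike integrability alone, this is stable under
    products, so polynomials in signals and posterior averages need no separate estimates. *)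
Definition moments f := measurable_fun setT f /\
  forall n, mu.-integrable setT (EFin \o (fun x => f x ^+ n)).

Lemma integrable_le f g : measurable_fun setT f -> (forall x, `|f x| <= g x) ->
  mu.-integrable setT (EFin \o g) -> mu.-integrable setT (EFin \o f).
Proof.
move=> mf fg; apply: le_integrable => //; first exact/measurable_EFinP.
by move=> x _ /=; rewrite lee_fin (le_trans (fg x))// ler_norm.
Qed.

Lemma moments_measurable f : moments f -> measurable_fun setT f.
Proof. by case. Qed.

Lemma moments_integrable f : moments f -> mu.-integrable setT (EFin \o f).
Proof.
move=> [mf /(_ 1%N)]; rewrite (_ : (fun x => f x ^+ 1) = f)//.
Qed.

Lemma moments_le f g : measurable_fun setT f -> (forall x, `|f x| <= `|g x|) ->
  moments g -> moments f.
Proof.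
move=> mf fg [mg ig]; split=> // n.
apply: (@integrable_le _ (fun x => `|g x ^+ n|)).
- exact: measurable_funX.
- by move=> x; rewrite !normrX lerXn2r// nnegrE.
- by have /integrable_abse := ig n.
Qed.

Lemma moments_cst (c : R) : moments (fun=> c).
Proof.
split=> // n; apply: (@integrable_le _ (fun=> `|c ^+ n|)) => //.
exact: (@finite_measure_integrable_cst _ _ _ mu).
Qed.

Lemma momentsM f g : moments f -> moments g -> moments (fun x => f x * g x).
Proof.
move=> [mf jf] [mg jg]; split=> [|n]; first exact: measurable_funM.
apply: (@integrable_le _ (fun x => f x ^+ (n * 2) + g x ^+ (n * 2))).
- by apply: measurable_funX; exact: measurable_funM.
- move=> x; rewrite exprMn !exprM normrM.
  rewrite -(real_normK (num_real (f x ^+ n))) -(real_normK (num_real (g x ^+ n))).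
  set u := `|f x ^+ n|; set v := `|g x ^+ n|; have := sqr_ge0 (u - v); have := sqr_ge0 u; have := sqr_ge0 v.
  nra.
- have := integrableD measurableT (jf (n * 2)%N) (jg (n * 2)%N).
  by apply: eq_integrable => // x _ /=; rewrite EFinD.
Qed.

Lemma momentsD f g : moments f -> moments g -> moments (fun x => f x + g x).
Proof.
move=> [mf jf] [mg jg]; split=> [|n]; first exact: measurable_funD.
apply: (@integrable_le _ (fun x => 2 ^+ n * `|f x ^+ n| + 2 ^+ n * `|g x ^+ n|)).
- by apply: measurable_funX; exact: measurable_funD.
- move=> x; rewrite !normrX -!exprMn.
  have [fg|/ltW fg] := leP `|f x| `|g x|.
    rewrite (@le_trans _ _ ((2 * `|g x|) ^+ n))//.
      by rewrite lerXn2r ?nnegrE ?mulr_ge0// (le_trans (ler_normD _ _))//; lra.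
    by rewrite lerDr exprn_ge0// mulr_ge0.
  rewrite (@le_trans _ _ ((2 * `|f x|) ^+ n))//.
    by rewrite lerXn2r ?nnegrE ?mulr_ge0// (le_trans (ler_normD _ _))//; lra.
  by rewrite lerDl exprn_ge0// mulr_ge0.
- have := integrableD measurableT
    (integrableZl measurableT (2 ^+ n) (integrable_abse (jf n)))
    (integrableZl measurableT (2 ^+ n) (integrable_abse (jg n))).
  by apply: eq_integrable => // x _ /=; rewrite EFinD.
Qed.

Lemma momentsZ (c : R) f : moments f -> moments (fun x => c * f x).
Proof. by move=> mf; apply: momentsM => //; exact: moments_cst. Qed.

Lemma momentsN f : moments f -> moments (fun x => - f x).
Proof.
move=> /(momentsZ (-1)); rewrite (_ : (fun x => -1 * f x) = (fun x => - f x))//.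
by apply/funext => x; rewrite mulN1r.
Qed.

Lemma momentsB f g : moments f -> moments g -> moments (fun x => f x - g x).
Proof. by move=> mf /momentsN; exact: momentsD. Qed.

Lemma momentsX f n : moments f -> moments (fun x => f x ^+ n).
Proof.
move=> mf; elim: n => [|n IH].
  rewrite (_ : (fun x => f x ^+ 0) = (fun=> 1)); last exact/funext.
  exact: moments_cst.
rewrite (_ : (fun x => f x ^+ n.+1) = (fun x => f x * f x ^+ n)).
  exact: momentsM.
by apply/funext => x; rewrite exprS.
Qed.

Lemma moments_sum (K : Type) (s : seq K) (F : K -> T -> R) :
  (forall k, moments (F k)) -> moments (fun x => \sum_(k <- s) F k x).
Proof.
move=> mF; elim: s => [|k s IH].
  rewrite (_ : (fun x => _) = (fun=> 0)); first exact: moments_cst.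
  by apply/funext => x; rewrite big_nil.
rewrite (_ : (fun x => _) = (fun x => F k x + \sum_(k <- s) F k x)).
  exact: momentsD.
by apply/funext => x; rewrite big_cons.
Qed.

Lemma moments_norm f : moments f -> moments (fun x => `|f x|).
Proof.
move=> mf; have [mf' _] := mf; apply: moments_le mf; first exact: measurableT_comp.
by move=> x; rewrite normr_id.
Qed.

Lemma RintegralD_moments f g : moments f -> moments g ->
  \int[mu]_x (f x + g x) = \int[mu]_x f x + \int[mu]_x g x.
Proof. by move=> mf mg; rewrite RintegralD//; exact: moments_integrable. Qed.

Lemma RintegralB_moments f g : moments f -> moments g ->
  \int[mu]_x (f x - g x) = \int[mu]_x f x - \int[mu]_x g x.
Proof. by move=> mf mg; rewrite RintegralB//; exact: moments_integrable. Qed.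

Lemma RintegralZ_moments (c : R) f : moments f ->
  \int[mu]_x (c * f x) = c * \int[mu]_x f x.
Proof. by move=> mf; rewrite RintegralZl//; exact: moments_integrable. Qed.

Lemma Rintegral_sum_moments (K : Type) (s : seq K) (F : K -> T -> R) :
  (forall k, moments (F k)) ->
  \int[mu]_x (\sum_(k <- s) F k x) = \sum_(k <- s) \int[mu]_x F k x.
Proof.
move=> mF; elim: s => [|k s IH].
  rewrite big_nil; under eq_Rintegral do rewrite big_nil.
  by rewrite Rintegral_cst// mul0r.
rewrite big_cons; under eq_Rintegral do rewrite big_cons.
by rewrite RintegralD_moments ?IH//; exact: moments_sum.
Qed.

Lemma Rintegral_cst_probability (c : R) : \int[mu]_x c = c.
Proof. by rewrite /Rintegral (integral_cst_probability mu). Qed.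

Lemma le_Rintegral_moments f g : moments f -> moments g ->
  (forall x, f x <= g x) -> \int[mu]_x f x <= \int[mu]_x g x.
Proof. by move=> mf mg fg; apply: le_Rintegral => //; exact: moments_integrable. Qed.

Lemma EFin_Rintegral_moments f : moments f ->
  (\int[mu]_x (f x)%:E = (\int[mu]_x f x)%R%:E)%E.
Proof.
move=> mf; rewrite /Rintegral fineK//.
exact: (integrable_fin_num measurableT (moments_integrable mf)).
Qed.

(** A power of [|f|] is at most 1 plus a larger even power. The exponents [2 ^ k] are those that
    Jensen's inequality for posteriors reaches by repeated squaring. *)
Lemma moments_even f : measurable_fun setT f ->
  (forall k, (0 < k)%N -> (\int[mu]_x (f x ^+ (2 ^ k))%:E < +oo)%E) -> moments f.
Proof.
move=> mf h; split=> // n.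
have e0 x k : (0 < k)%N -> 0 <= f x ^+ (2 ^ k).
  by case: k => // k _; rewrite expnS exprM exprn_ge0// sqr_ge0.
apply: (@integrable_le _ (fun x => 1 + f x ^+ (2 ^ n.+1))).
- exact: measurable_funX.
- move=> x; rewrite normrX; have [f1|f1] := leP `|f x| 1.
    rewrite (@le_trans _ _ 1)//; first by rewrite exprn_ile1.
    by rewrite lerDl e0.
  rewrite (@le_trans _ _ (`|f x| ^+ (2 ^ n.+1)))//.
    by rewrite ler_weXn2l ?(ltW f1)// ltnW// ltnW// ltn_expl.
  by rewrite -normrX ger0_norm ?e0// lerDr.
- apply/integrableP; split.
    by apply/measurable_EFinP; apply: measurable_funD => //; exact: measurable_funX.
  under eq_integral => x _.
    rewrite /= ger0_norm; last by rewrite addr_ge0// e0.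
    rewrite EFinD; over.
  rewrite ge0_integralD//.
  + rewrite (integral_cst_probability mu) lte_add_pinfty// ?ltry// h//.
  + by move=> x _; rewrite lee_fin e0.
  + by apply/measurable_EFinP; exact: measurable_funX.
Qed.

End moments.

Section law_moments.
Context d d' (T : measurableType d) (T' : measurableType d') (R : realType).
Variables (P : probability T R) (Q : probability T' R).

Lemma has_law_moments X (f : T' -> R) : has_law P Q X ->
  moments Q f -> moments P (f \o X).
Proof.
move=> lX [mf jf]; have [mX _] := lX; split; first exact: measurableT_comp.
move=> n; have me : measurable_fun setT (EFin \o (fun x => f x ^+ n)).
  by apply/measurable_EFinP; exact: measurable_funX.
exact: (has_law_integrable lX me).1 (jf n).
Qed.

Lemma has_law_Rintegral X (f : T' -> R) : has_law P Q X ->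
  measurable_fun setT f -> \int[Q]_y f y = \int[P]_x f (X x).
Proof.
move=> lX mf; rewrite /Rintegral; congr fine.
exact: (@has_law_integral _ _ _ _ _ _ _ _ (EFin \o f) lX (measurableT_comp _ mf)).
Qed.

End law_moments.

Section stein.
Context d (T : measurableType d) (R : realType) (mu : probability T R).
Notation gam := (@gauss R).

(** [resample] redraws the coordinate [crd], so disintegrating over it reduces the claim to
    [gauss_stein] in one variable, whose integrability conditions hold for almost every [s]. *)
Lemma stein (resample : T * R -> T) (crd F f : T -> R) :
  has_law (mu \x gam)%E mu resample ->
  (forall s t, crd (resample (s, t)) = t) ->
  (forall s (t : R), is_derive t (1:R) (fun t => F (resample (s, t))) (f (resample (s, t)))) ->
  (forall s, continuous (fun t => f (resample (s, t)))) ->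
  moments mu crd -> moments mu F -> moments mu f ->
  \int[mu]_x (crd x * F x) = \int[mu]_x f x.
Proof.
move=> lr crdE dF cf mc mF mf.
have mcF := momentsM mc mF.
have H (g : T -> R) : moments mu g -> [/\ measurable_fun setT g,
    (mu \x gam)%E.-integrable setT (fun p => (g (resample p))%:E) &
    (\int[mu]_x (g x)%:E = \int[mu]_s \int[gam]_t (g (resample (s, t)))%:E)%E].
  move=> mg; have ig := moments_integrable mg; have [m _] := mg.
  have me : measurable_fun setT (EFin \o g) by exact/measurable_EFinP.
  have i2 := (has_law_integrable lr me).1 ig.
  split=> //.
  rewrite (has_law_integral lr me) (integral12_prod_meas1 i2)//.
have [m1 i1 e1] := H _ mcF; have [m2 i2 e2] := H _ mF; have [m3 i3 e3] := H _ mf.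
rewrite /Rintegral; congr fine; rewrite e1 e3.
apply: ae_eq_integral => //.
- exact: (measurable_fubini_F i1).
- exact: (measurable_fubini_F i3).
have := ae_integrable1 i1; have := ae_integrable1 i2; have := ae_integrable1 i3.
apply: filterS3 => s j3 j2 j1 _.
under eq_integral do rewrite crdE.
apply: gauss_stein => //.
by move: j1; apply: eq_integrable => // t _ /=; rewrite crdE.
Qed.

End stein.

(** * Posterior averages in a Gaussian channel *)

Section channel.
Context d (T : measurableType d) (R : realType) (P : probability T R).
Variables (J : finType) (a : J -> T -> R).
Hypothesis ma : forall j, moments P (a j).
Notation X := (gsp J R).
Notation noise := (gP R (enum J)).
Notation m := (P \x noise)%E.
Implicit Types p : T -> R.

(** The density at [x] of the Gaussian law N(a(t), I) with respect to N(0, I). *)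
Definition lik_ratio (x : J -> R) (t : T) : R :=
  expR (\sum_j (a j t * x j - a j t ^+ 2 / 2)).
Notation L := lik_ratio.

(* [upost p] is the unnormalized posterior: the integral of [p] against the
   likelihood relative to pure noise. *)
Definition upost p (x : J -> R) : R := \int[P]_t (p t * L x t).
Definition evidence (x : J -> R) : R := upost (fun=> 1) x.
Definition post p (x : J -> R) : R := upost p x / evidence x.
Notation Z := evidence.

Definition observe (q : T * X) : X := fun j => q.2 j + a j q.1.

Lemma lik_ratio_ge0 x t : 0 <= L x t. Proof. exact: expR_ge0. Qed.

(** By completing the square. The bound is uniform in [t], so weighting by the likelihood preserves
    [moments] whatever the size of the signal. *)
Lemma lik_ratio_le x t : L x t <= expR (\sum_j x j ^+ 2 / 2).
Proof.
rewrite ler_expR; apply: ler_sum => j _; have := sqr_ge0 (a j t - x j); nra.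
Qed.

Lemma measurable_a j : measurable_fun setT (a j).
Proof. exact: moments_measurable. Qed.

Lemma measurable_lik_ratio d' (T' : measurableType d') (f : T' -> X) (g : T' -> T) :
  measurable_fun setT f -> measurable_fun setT g ->
  measurable_fun setT (fun q => L (f q) (g q)).
Proof.
move=> mf mg; apply: measurableT_comp => //; apply: measurable_sum => j.
have mag : measurable_fun setT (fun q => a j (g q)).
  exact: measurableT_comp (measurable_a j) mg.
apply: measurable_funB; apply: measurable_funM => //.
- exact: measurable_gsp_comp.
- exact: measurable_funX.
Qed.

Lemma measurable_observe : measurable_fun setT observe.
Proof.
apply: measurable_gsp => j; apply: measurable_funD.
- exact: measurable_gsp_comp measurable_snd.
- exact: measurableT_comp (measurable_a j) measurable_fst.
Qed.

Lemma moments_lik_ratio p x : moments P p -> moments P (fun t => p t * L x t).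
Proof.
move=> mp; have mp' := moments_measurable mp.
apply: (@moments_le _ _ _ _ _ (fun t => expR (\sum_j x j ^+ 2 / 2) * p t)).
- apply: measurable_funM => //.
  by apply: measurable_lik_ratio => //; exact: measurable_cst.
- move=> t; rewrite !normrM mulrC ler_wpM2r//.
  rewrite (ger0_norm (lik_ratio_ge0 _ _)) (ger0_norm (expR_ge0 _)).
  exact: lik_ratio_le.
- exact: momentsZ.
Qed.

Let m1 : moments P (fun=> 1). Proof. exact: moments_cst. Qed.

Lemma upostD p1 p2 x : moments P p1 -> moments P p2 ->
  upost (fun t => p1 t + p2 t) x = upost p1 x + upost p2 x.
Proof.
move=> mp1 mp2; rewrite /upost -RintegralD_moments; [|exact: moments_lik_ratio..].
by apply: eq_Rintegral => t _; rewrite mulrDl.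
Qed.

Lemma upostZ c p x : moments P p -> upost (fun t => c * p t) x = c * upost p x.
Proof.
move=> mp; rewrite /upost -RintegralZ_moments; last exact: moments_lik_ratio.
by apply: eq_Rintegral => t _; rewrite mulrA.
Qed.

Lemma upost_ge0 p x : (forall t, 0 <= p t) -> 0 <= upost p x.
Proof.
by move=> p0; apply: Rintegral_ge0 => t _; rewrite mulr_ge0// lik_ratio_ge0.
Qed.

Lemma upost_cst c x : upost (fun=> c) x = c * Z x.
Proof. by rewrite -upostZ//; congr upost; apply/funext => t; rewrite mulr1. Qed.

(** Jensen's inequality for the exponential, through its tangent line at the mean [c] of the
    exponent [e]: [expR (e t)] is at least [expR c * (1 - c + e t)]. *)
Lemma evidence_gt0 x : 0 < Z x.
Proof.
pose e t := \sum_j (a j t * x j - a j t ^+ 2 / 2).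
have me : moments P e.
  apply: moments_sum => j; apply: momentsB.
    by apply: momentsM => //; exact: moments_cst.
  by apply: momentsM; [exact: momentsX|exact: moments_cst].
pose c := \int[P]_t e t.
apply: (@lt_le_trans _ _ (expR c)); first exact: expR_gt0.
have -> : expR c = \int[P]_t (expR c * (1 - c + e t)).
  rewrite RintegralZ_moments; last by apply: momentsD => //; exact: moments_cst.
  rewrite RintegralD_moments ?Rintegral_cst_probability//; last exact: moments_cst.
  by rewrite -/c subrK mulr1.
apply: le_Rintegral_moments.
- by apply: momentsZ; apply: momentsD => //; exact: moments_cst.
- exact: moments_lik_ratio.
move=> t; rewrite mul1r /lik_ratio -/(e t) -[e t in leRHS](subrK c) expRD mulrC.
rewrite ler_wpM2r ?expR_ge0//.
by apply: le_trans (expR_ge1Dx _); lra.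
Qed.

Lemma evidence_neq0 x : Z x != 0. Proof. by rewrite gt_eqF// evidence_gt0. Qed.

Lemma postD p1 p2 x : moments P p1 -> moments P p2 ->
  post (fun t => p1 t + p2 t) x = post p1 x + post p2 x.
Proof. by move=> mp1 mp2; rewrite /post upostD// mulrDl. Qed.

Lemma postZ c p x : moments P p -> post (fun t => c * p t) x = c * post p x.
Proof. by move=> mp; rewrite /post upostZ// mulrA. Qed.

Lemma post_cst c x : post (fun=> c) x = c.
Proof.
rewrite (_ : (fun=> c) = (fun t : T => c * 1)); last by apply/funext => t; rewrite mulr1.
by rewrite postZ// /post divff ?mulr1// evidence_neq0.
Qed.

Lemma postB p1 p2 x : moments P p1 -> moments P p2 ->
  post (fun t => p1 t - p2 t) x = post p1 x - post p2 x.
Proof.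
move=> mp1 mp2; rewrite -[- post p2 x]mulN1r -postZ// -postD//; last exact: momentsZ.
by congr post; apply/funext => t; rewrite mulN1r.
Qed.

Lemma post_sum (K : Type) (s : seq K) (F : K -> T -> R) x :
  (forall k, moments P (F k)) ->
  post (fun t => \sum_(k <- s) F k t) x = \sum_(k <- s) post (F k) x.
Proof.
move=> mF; elim: s => [|k s IH].
  by rewrite big_nil; under eq_fun do rewrite big_nil; rewrite post_cst.
rewrite big_cons; under eq_fun do rewrite big_cons.
by rewrite postD ?IH//; exact: moments_sum.
Qed.

Lemma post_ge0 p x : (forall t, 0 <= p t) -> 0 <= post p x.
Proof. by move=> p0; rewrite divr_ge0// ?upost_ge0// ltW// evidence_gt0. Qed.

Lemma upostE p x : upost p x = post p x * Z x.
Proof. by rewrite /post divfK// evidence_neq0. Qed.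

Lemma post_sqr_le p x : moments P p -> post p x ^+ 2 <= post (fun t => p t ^+ 2) x.
Proof.
move=> mp; have mp2 := momentsX 2 mp; set c := post p x.
have : 0 <= post (fun t => (p t ^+ 2 - 2 * c * p t) + c ^+ 2) x.
  apply: post_ge0 => t; rewrite (_ : _ + _ = (p t - c) ^+ 2) ?sqr_ge0//; ring.
have mcp : moments P (fun t => 2 * c * p t) by exact: momentsZ.
rewrite postD; [|exact: momentsB|exact: moments_cst].
by rewrite postB// postZ// post_cst -/c; nra.
Qed.

(** Each squaring is one use of [post_sqr_le]. *)
Lemma post_expr_le p x k : moments P p ->
  post p x ^+ (2 ^ k) <= post (fun t => p t ^+ (2 ^ k)) x.
Proof.
move=> mp; elim: k p mp => [|k IH] p mp.
  by rewrite expn0 expr1; under eq_fun do rewrite expr1.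
rewrite expnS exprM; under eq_fun do rewrite exprM.
have mp2 := momentsX 2 mp.
apply: le_trans (IH _ mp2).
by rewrite lerXn2r ?nnegrE ?sqr_ge0 ?post_sqr_le//; apply: post_ge0 => t; exact: sqr_ge0.
Qed.

(* Cameron-Martin: the density of the joint law of (parameter, observation) with
   respect to prior x noise is [lik_ratio]. *)
Lemma ge0_bayes (F : T * X -> \bar R) :
  measurable_fun setT F -> (forall q, (0 <= F q)%E) ->
  (\int[m]_q F (q.1, observe q) = \int[m]_q (F q * (L q.2 q.1)%:E))%E.
Proof.
move=> mF F0.
have mo : measurable_fun setT (fun q : T * X => (q.1, observe q)).
  by apply: measurable_fun_pair => //; exact: measurable_observe.
rewrite (@fubini_tonelli1 _ _ _ _ _ _ _ (fun q => F (q.1, observe q)))//; last first.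
  exact: measurableT_comp mF mo.
have mL : measurable_fun setT (fun q : T * X => L q.2 q.1).
  by apply: measurable_lik_ratio; [exact: measurable_snd|exact: measurable_fst].
rewrite (@fubini_tonelli1 _ _ _ _ _ _ _ (fun q => (F q * (L q.2 q.1)%:E)%E))//; last 2 first.
- by apply: emeasurable_funM => //; exact/measurable_EFinP.
- by move=> q; rewrite mule_ge0// lee_fin lik_ratio_ge0.
apply: eq_integral => t _; rewrite /fubini_F /=.
have mFt : measurable_fun setT (fun x : X => F (t, x)).
  by apply: measurableT_comp => //; exact: pair1_measurable.
have := @ge0_integral_gP_shift _ _ _ (fun j => a j t) _ (enum_uniq J) mFt (fun x => F0 (t, x)).
under eq_integral => x _.
  rewrite (_ : (fun j => _) = observe (t, x)); last first.
    by apply/funext => j; rewrite mem_enum.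
  over.
move=> ->; apply: eq_integral => x _; congr (_ * _%:E)%E.
by rewrite /tilt /lik_ratio expR_sum big_enum.
Qed.

Lemma measurable_lik_pair : measurable_fun setT (fun q : T * X => L q.2 q.1).
Proof. by apply: measurable_lik_ratio; [exact: measurable_snd|exact: measurable_fst]. Qed.

Lemma measurable_joint : measurable_fun setT (fun q : T * X => (q.1, observe q)).
Proof. by apply: measurable_fun_pair => //; exact: measurable_observe. Qed.

Lemma bayes (F : T * X -> R) : measurable_fun setT F ->
  (\int[m]_q (F (q.1, observe q))%:E = \int[m]_q (F q * L q.2 q.1)%:E)%E.
Proof.
move=> mF; have meF : measurable_fun setT (EFin \o F) by exact/measurable_EFinP.
rewrite integralE [RHS]integralE.
have mp := measurable_funepos meF; have mn := measurable_funeneg meF.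
have hp := ge0_bayes mp (funepos_ge0 _); have hn := ge0_bayes mn (funeneg_ge0 _).
congr (_ - _)%E.
- transitivity (\int[m]_q (EFin \o F)^\+ (q.1, observe q))%E.
    by apply: eq_integral => q _; rewrite !funeposE.
  rewrite hp; apply: eq_integral => q _.
  by rewrite !funeposE -!EFin_max -EFinM maxr_pMl ?lik_ratio_ge0// mul0r.
- transitivity (\int[m]_q (EFin \o F)^\- (q.1, observe q))%E.
    by apply: eq_integral => q _; rewrite !funenegE.
  rewrite hn; apply: eq_integral => q _.
  by rewrite !funenegE/= -!EFin_max -EFinM maxr_pMl ?lik_ratio_ge0// mul0r mulNr.
Qed.

Lemma bayes_integrable (F : T * X -> R) : measurable_fun setT F ->
  m.-integrable setT (EFin \o (fun q => F (q.1, observe q))) <->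
  m.-integrable setT (EFin \o (fun q => F q * L q.2 q.1)).
Proof.
move=> mF.
have mFo : measurable_fun setT (fun q : T * X => F (q.1, observe q)).
  exact: measurableT_comp mF measurable_joint.
have mFL : measurable_fun setT (fun q : T * X => F q * L q.2 q.1).
  by apply: measurable_funM => //; exact: measurable_lik_pair.
have e : (\int[m]_q `|(F (q.1, observe q))%:E| = \int[m]_q `|(F q * L q.2 q.1)%:E|)%E.
  rewrite (@ge0_bayes (fun q => `|(F q)%:E|)%E); last 2 first.
  - by apply: measurableT_comp => //; exact/measurable_EFinP.
  - by move=> q; exact: abse_ge0.
  by apply: eq_integral => q _; rewrite EFinM abseM (@gee0_abs _ (L _ _)%:E)// lee_fin lik_ratio_ge0.
split=> /integrableP[_ h]; apply/integrableP; split; try exact/measurable_EFinP.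
- by rewrite -e.
- by rewrite e.
Qed.

Lemma has_law_fst : has_law m P fst.
Proof.
apply: has_lawI => [|f mf f0]; first exact: measurable_fst.
rewrite (@fubini_tonelli1 _ _ _ _ _ _ _ (fun q => f q.1))//; last exact: measurableT_comp.
by apply: eq_integral => t _; rewrite /fubini_F/= (integral_cst_probability noise).
Qed.

Lemma moments_fst p : moments P p -> moments m (p \o fst).
Proof. exact: has_law_moments has_law_fst. Qed.

Lemma integrable_lik p : moments P p ->
  m.-integrable setT (fun q => (p q.1 * L q.2 q.1)%:E).
Proof.
move=> mp; have mp' := moments_measurable mp.
apply/(@bayes_integrable (p \o fst)); first exact: measurableT_comp.
exact: (moments_integrable (moments_fst mp)).
Qed.

Lemma measurable_upost p : moments P p -> measurable_fun setT (upost p : X -> R).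
Proof.
move=> mp; have := measurable_fubini_G (integrable_lik mp).
by move=> h; exact: (measurableT_comp (@fine_measurable R setT measurableT) h).
Qed.

Lemma measurable_post p : moments P p -> measurable_fun setT (post p : X -> R).
Proof.
move=> mp; apply: measurable_funM; first exact: measurable_upost.
(* Since [Z] is positive, its inverse is a composition of measurable functions. *)
rewrite (_ : (fun x : X => (Z x)^-1) = (fun x => expR (- ln (Z x)))).
  apply: measurableT_comp => //; apply: measurableT_comp => //.
  by apply: measurableT_comp; [exact: measurable_ln|exact: measurable_upost].
by apply/funext => x; rewrite expRN lnK// posrE evidence_gt0.
Qed.

Lemma EFin_upost p x : moments P p ->
  (\int[P]_t (p t * L x t)%:E = (upost p x)%:E)%E.
Proof. by move=> mp; rewrite EFin_Rintegral_moments//; exact: moments_lik_ratio. Qed.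


(** For nonnegative functions Tonelli applies before [post r] is known to be integrable;
    [moments_post] obtains that integrability from here. *)
Lemma ge0_tower r : moments P r -> (forall t, 0 <= r t) ->
  (\int[m]_q (post r (observe q))%:E = \int[m]_q (r q.1)%:E)%E.
Proof.
move=> mr r0; have mr' := moments_measurable mr.
have mp : measurable_fun setT (fun x : X => post r x) by exact: measurable_post.
have mp2 : measurable_fun setT (fun q : T * X => post r q.2).
  by apply: measurableT_comp mp _; exact: measurable_snd.
have mr1 : measurable_fun setT (fun q : T * X => r q.1).
  by apply: measurableT_comp => //; exact: measurable_fst.
rewrite (bayes mp2) (bayes mr1).
rewrite (@fubini_tonelli2 _ _ _ _ _ _ _ (fun q : T * X => (post r q.2 * L q.2 q.1)%:E)); last 2 first.
- by apply/measurable_EFinP; apply: measurable_funM => //; exact: measurable_lik_pair.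
- by move=> q; rewrite lee_fin mulr_ge0 ?lik_ratio_ge0// post_ge0.
rewrite (@fubini_tonelli2 _ _ _ _ _ _ _ (fun q : T * X => (r q.1 * L q.2 q.1)%:E)); last 2 first.
- by apply/measurable_EFinP; apply: measurable_funM => //; exact: measurable_lik_pair.
- by move=> q; rewrite lee_fin mulr_ge0 ?lik_ratio_ge0.
apply: eq_integral => x _; rewrite /fubini_G /=.
rewrite (EFin_upost _ mr) (EFin_upost _ (moments_cst P (post r x))).
by rewrite upost_cst -upostE.
Qed.

Lemma moments_post p : moments P p -> moments m (post p \o observe).
Proof.
move=> mp.
have mpo : measurable_fun setT (post p \o observe).
  exact: measurableT_comp (measurable_post mp) measurable_observe.
apply: moments_even => // k k0.
have mpk := momentsX (2 ^ k) mp.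
have e0 (x : R) : 0 <= x ^+ (2 ^ k).
  by case: k k0 {mpk} => // k _; rewrite expnS exprM exprn_ge0// sqr_ge0.
apply: (@le_lt_trans _ _ (\int[m]_q (post (fun t => p t ^+ (2 ^ k)) (observe q))%:E)%E).
  apply: ge0_le_integral => //.
  - by move=> q _; rewrite lee_fin.
  - by apply/measurable_EFinP; exact: measurable_funX.
  - apply/measurable_EFinP.
    exact: measurableT_comp (measurable_post mpk) measurable_observe.
  - by move=> q _; rewrite lee_fin post_expr_le.
rewrite ge0_tower//.
have /integrableP[_] := moments_integrable (moments_fst mpk).
by under eq_integral do rewrite gee0_abs ?lee_fin//=.
Qed.

(** By Bayes' formula both sides become the integral over pure noise of [post p x * Phi x] times the
    evidence. Against a function of the observation, the signal and its posterior average are thus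
    interchangeable. *)
Lemma tower p (Phi : X -> R) : moments P p -> measurable_fun setT Phi ->
  moments m (Phi \o observe) ->
  \int[m]_q (p q.1 * Phi (observe q)) = \int[m]_q (post p (observe q) * Phi (observe q)).
Proof.
move=> mp mPhi mPo; have mp' := moments_measurable mp.
have mP2 : measurable_fun setT (fun q : T * X => Phi q.2).
  by apply: measurableT_comp mPhi _; exact: measurable_snd.
have mF1 : measurable_fun setT (fun q : T * X => p q.1 * Phi q.2).
  by apply: measurable_funM => //; apply: measurableT_comp => //; exact: measurable_fst.
have mF2 : measurable_fun setT (fun q : T * X => post p q.2 * Phi q.2).
  apply: measurable_funM => //; apply: measurableT_comp (measurable_post mp) _.
  exact: measurable_snd.
have i1 := moments_integrable (momentsM (moments_fst mp) mPo).
have i2 := moments_integrable (momentsM (moments_post mp) mPo).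
rewrite /Rintegral; congr fine; rewrite (bayes mF1) (bayes mF2).
rewrite -(integral21_prod_meas1 ((bayes_integrable mF1).1 i1)).
rewrite -(integral21_prod_meas1 ((bayes_integrable mF2).1 i2)).
apply: eq_integral => x _; rewrite /fubini_G /=.
rewrite (EFin_upost _ (moments_cst P (post p x * Phi x))).
under eq_integral do rewrite (mulrC (p _)).
rewrite (EFin_upost _ (momentsZ (Phi x) mp)) upostZ//.
by rewrite upost_cst upostE; apply: congr1; ring.
Qed.

Lemma is_derive_bigsum (K : Type) (s : seq K) (F : K -> R -> R) (dF : K -> R) (t : R) :
  (forall k, is_derive t (1:R) (F k) (dF k)) ->
  is_derive t (1:R) (fun u => \sum_(k <- s) F k u) (\sum_(k <- s) dF k).
Proof.
move=> h; elim: s => [|k s IH].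
  rewrite big_nil (_ : (fun u => _) = cst 0); first exact: is_derive_cst.
  by apply/funext => u; rewrite big_nil.
rewrite big_cons (_ : (fun u => _) = F k + (fun u => \sum_(k <- s) F k u)).
  exact: is_deriveD.
by apply/funext => u; rewrite big_cons.
Qed.

Lemma continuous_bigsum (K : Type) (s : seq K) (F : K -> R -> R) :
  (forall k, continuous (F k)) -> continuous (fun u => \sum_(k <- s) F k u).
Proof.
move=> h; elim: s => [|k s IH].
  rewrite (_ : (fun u => _) = cst 0); first exact: cst_continuous.
  by apply/funext => u; rewrite big_nil.
rewrite (_ : (fun u => _) = (fun u => F k u + \sum_(k <- s) F k u)).
  by move=> u; apply: cvgD; [exact: h|exact: IH].
by apply/funext => u; rewrite big_cons.
Qed.

(** * Derivatives of posterior averages along a curve of observations *)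

Section curve.
Variables (y y' : J -> R -> R).
Hypothesis dy : forall j (t : R), is_derive t (1:R) (y j) (y' j t).
Hypothesis cy' : forall j, continuous (y' j).
Notation yt t := (fun j => y j t).

Let cy j : continuous (y j).
Proof.
by move=> t; apply: differentiable_continuous; apply/derivable1_diffP; case: (dy j t).
Qed.

Lemma is_derive_lik_ratio (t : R) th :
  is_derive t (1:R) (fun u => L (yt u) th) (L (yt t) th * \sum_j a j th * y' j t).
Proof.
have h : is_derive t (1:R) (fun u => \sum_j (a j th * y j u - a j th ^+ 2 / 2)) (\sum_j a j th * y' j t).
  apply: is_derive_bigsum => j; have := dy j t => h.
  by apply: is_derive_eq; rewrite /GRing.scale/=; ring.
exact: (@is_derive1_comp _ _ _ t _ _ (is_derive_expR _) h).
Qed.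

(** Bounds that are uniform near [t], from which the dominating function for differentiation under
    the integral is built. *)
Lemma curve_bounded (t : R) : exists C : R, forall u, `]t - 1, t + 1[%classic u ->
  (\sum_j y j u ^+ 2 / 2 <= C) /\ forall j, `|y' j u| <= C.
Proof.
pose S u := \sum_j (y j u ^+ 2 + y' j u ^+ 2).
have cS : continuous S.
  apply: continuous_bigsum => j u.
  by apply: cvgD; apply: cvgM; [exact: cy|exact: cy|exact: cy'|exact: cy'].
have t1 : t - 1 <= t + 1 by lra.
have [c _ cmax] := EVT_max t1 (continuous_subspaceT cS).
(* The added 1 turns a bound on the square of [y' j u] into one on its absolute value. *)
exists (1 + S c) => u; rewrite /= in_itv/= => /andP[u1 u2].
have Su : S u <= S c by apply: cmax => //; rewrite in_itv/= !ltW.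
split.
  have : \sum_j y j u ^+ 2 / 2 <= S u.
    by apply: ler_sum => j _; have := sqr_ge0 (y j u); have := sqr_ge0 (y' j u); lra.
  lra.
move=> j; have : y' j u ^+ 2 <= S u.
  rewrite /S (bigD1 j)//= addrAC.
  have : 0 <= \sum_(i | i != j) (y i u ^+ 2 + y' i u ^+ 2).
    by apply: sumr_ge0 => i _; rewrite addr_ge0// sqr_ge0.
  have := sqr_ge0 (y j u); lra.
rewrite -(real_normK (num_real (y' j u))); have := normr_ge0 (y' j u); nra.
Qed.

Lemma is_derive_upost p (t : R) : moments P p ->
  is_derive t (1:R) (fun u => upost p (yt u))
    (\sum_j y' j t * upost (fun th => p th * a j th) (yt t)).
Proof.
move=> mp.
pose f u th := p th * L (yt u) th.
have df u th : is_derive u (1:R) (fun u => f u th) (f u th * \sum_j a j th * y' j u).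
  have := is_derive_lik_ratio u th => h.
  by apply: is_derive_eq; rewrite /f /GRing.scale/=; ring.
have d1E u th : partial1of2 f u th = f u th * \sum_j a j th * y' j u.
  by rewrite partial1of2E; case: (df u th).
have [C HC] := curve_bounded t.
pose G th := `|p th| * (expR C * \sum_j `|a j th| * C).
have C0 : 0 <= C.
  have [] := HC t _; first by rewrite /= in_itv/=; apply/andP; split; lra.
  by move=> h _; apply: le_trans h; apply: sumr_ge0 => j _; rewrite divr_ge0// sqr_ge0.
have mG : moments P G.
  apply: momentsM; first exact: moments_norm.
  apply: momentsZ; apply: moments_sum => j; apply: momentsM; last exact: moments_cst.
  exact: moments_norm.
have It : `]t - 1, t + 1[%classic t by rewrite /= in_itv/=; apply/andP; split; lra.
have intf x : `]t - 1, t + 1[%classic x -> P.-integrable setT (EFin \o f x).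
  by move=> _; apply: moments_integrable; exact: moments_lik_ratio.
have derf x th : `]t - 1, t + 1[%classic x -> setT th -> derivable (f ^~ th) x 1.
  by move=> _ _; case: (df x th).
have G0 th : 0 <= G th.
  rewrite mulr_ge0// mulr_ge0 ?expR_ge0//; apply: sumr_ge0 => j _; exact: mulr_ge0.
have Gub x th : `]t - 1, t + 1[%classic x -> setT th -> `|partial1of2 f x th| <= G th.
  move=> xI _; have [h1 h2] := HC x xI.
  rewrite d1E /f /G -mulrA normrM ler_wpM2l// normrM ler_pM//.
    rewrite ger0_norm ?lik_ratio_ge0//; apply: le_trans (lik_ratio_le _ _) _.
    by rewrite ler_expR.
  apply: le_trans (ler_norm_sum _ _ _) _; apply: ler_sum => j _.
  by rewrite normrM ler_wpM2l.
have iG := moments_integrable mG.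
have D1 := derivable_under_integral measurableT It intf derf G0 iG Gub.
have D2 := differentiation_under_integral measurableT It intf derf G0 iG Gub.
apply: DeriveDef; first exact: D1.
rewrite -derive1E D2.
transitivity (\int[P]_th (\sum_j y' j t * (p th * a j th * L (yt t) th))).
  apply: eq_Rintegral => th _; rewrite d1E /f mulr_sumr; apply: eq_bigr => j _; ring.
have mpa j : moments P (fun th => p th * a j th) by exact: momentsM.
rewrite Rintegral_sum_moments; last first.
  by move=> j; apply: momentsZ; exact: moments_lik_ratio.
by apply: eq_bigr => j _; rewrite RintegralZ_moments//; exact: moments_lik_ratio.
Qed.

(** The quotient rule for [upost p] over the evidence: the coefficient of [y' j t] is the posterior
    covariance of [p] and [a j]. *)
Lemma is_derive_post p (t : R) : moments P p ->
  is_derive t (1:R) (fun u => post p (yt u))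
    (\sum_j y' j t * (post (fun th => p th * a j th) (yt t) -
                      post p (yt t) * post (a j) (yt t))).
Proof.
move=> mp; have h1 := is_derive_upost t mp; have h2 := is_derive_upost t m1.
have Z0 : Z (yt t) != 0 by exact: evidence_neq0.
set S1 := \sum_j _ in h1; set S2 := \sum_j _ in h2.
have h3 : is_derive t (1:R) (fun u => (Z (yt u))^-1) (- (Z (yt t)) ^- 2 * S2).
  by have [d2 e2] := h2; apply: DeriveDef; [exact: derivableV|rewrite deriveV// e2].
have -> : \sum_j y' j t * (post (fun th => p th * a j th) (yt t) -
    post p (yt t) * post (a j) (yt t)) =
    upost p (yt t) *: (- (Z (yt t)) ^- 2 * S2) + (Z (yt t))^-1 *: S1.
  under eq_bigr do rewrite mulrBr.
  have S2E : S2 = \sum_j y' j t * upost (a j) (yt t).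
    by apply: eq_bigr => j _; congr (_ * upost _ _); apply/funext => th; rewrite mul1r.
  rewrite sumrB addrC S2E /S1 /GRing.scale/= !mulr_sumr; congr (_ + _).
    rewrite -sumrN; apply: eq_bigr => j _; rewrite /post; field; exact: Z0.
  by apply: eq_bigr => j _; rewrite /post; ring.
exact: is_deriveM h1 h3.
Qed.

Lemma continuous_post p : moments P p -> continuous (fun u => post p (yt u)).
Proof.
move=> mp u; apply: differentiable_continuous; apply/derivable1_diffP.
by case: (is_derive_post u mp).
Qed.

End curve.

End channel.

(** * The quadratic inequality for the overlap *)

Section coordinates.
Variables (I : finType) (R : realType).
Notation P := (gP R (enum I)).
Notation gam := (@gauss R).

Lemma moments_coord (i : I) : moments P (fun w => w i).
Proof.
split=> [|n]; first exact: measurable_coord.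
apply: (@integrable_le _ _ _ _ _ (fun w : gsp I R => expR (n%:R * \sum_(i <- enum I) `|w i|))).
- by apply: measurable_funX; exact: measurable_coord.
- move=> w; rewrite normrX expRM_natl lerXn2r ?nnegrE ?expR_ge0//.
  apply: (@le_trans _ _ (1 + \sum_(i <- enum I) `|w i|)); last exact: expR_ge1Dx.
  rewrite big_enum (bigD1 i)//= addrCA lerDl addr_ge0//.
  exact: sumr_ge0.
- apply/integrableP; split.
    apply/measurable_EFinP; apply: measurableT_comp => //; apply: measurable_funM => //.
    apply: measurable_sum => j; apply: measurableT_comp => //; exact: measurable_coord.
  under eq_integral do rewrite gee0_abs ?lee_fin ?expR_ge0//=.
  exact: integral_gP_expR_norm (enum_uniq I).
Qed.

Lemma has_law_upd_enum (i : I) : has_law (P \x gam)%E P (fun p => upd p.1 i p.2).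
Proof. by apply: has_law_upd; rewrite mem_enum. Qed.

Lemma stein_coord (i : I) (F f : gsp I R -> R) :
  (forall w (t : R), is_derive t (1:R) (fun t => F (upd w i t)) (f (upd w i t))) ->
  (forall w, continuous (fun t => f (upd w i t))) ->
  moments P F -> moments P f ->
  \int[P]_w (w i * F w) = \int[P]_w f w.
Proof.
move=> dF cf mF mf.
apply: (stein (has_law_upd_enum i) _ _ _ (moments_coord i)) => //.
by move=> w t; rewrite /upd eqxx.
Qed.

Lemma is_derive_upd (w : I -> R) (i k : I) (t : R) :
  is_derive t (1:R) (fun t => upd w i t k) (k == i)%:R.
Proof. by rewrite /upd; case: eqP => _; [exact: is_derive_id|exact: is_derive_cst]. Qed.

Lemma continuous_upd (w : I -> R) (i k : I) : continuous (fun t => upd w i t k).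
Proof.
by move=> t; rewrite /upd; case: eqP => _; [exact: cvg_id|exact: cvg_cst].
Qed.

Lemma integral_coord_mul (k l : I) : \int[P]_w (w k * w l) = (l == k)%:R.
Proof.
transitivity (\int[P]_w (l == k)%:R); last exact: Rintegral_cst_probability.
apply: (@stein_coord k (fun w => w l)).
- by move=> w t; exact: is_derive_upd.
- by move=> w; exact: cst_continuous.
- exact: moments_coord.
- exact: moments_cst.
Qed.

(** Stein's identity in coordinate [k] for [w k * w l ^+ 2], whose derivative is again a multiple of
    [w l ^+ 2]. *)
Lemma integral_coord_sqr_mul (k l : I) :
  \int[P]_w (w k ^+ 2 * w l ^+ 2) = 1 + 2 * (l == k)%:R.
Proof.
have m2 := momentsX 2 (moments_coord l).
transitivity (\int[P]_w (w k * (w k * w l ^+ 2))).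
  by apply: eq_Rintegral => w _; ring.
transitivity (\int[P]_w ((1 + 2 * (l == k)%:R) * w l ^+ 2)); last first.
  rewrite RintegralZ_moments//; under eq_Rintegral do rewrite expr2.
  by rewrite integral_coord_mul eqxx mulr1.
apply: (@stein_coord k (fun w => w k * w l ^+ 2)).
- move=> w t; have h1 := is_derive_upd w k k t; have h2 := is_derive_upd w k l t.
  apply: is_derive_eq; rewrite /GRing.scale/= eqxx.
  by rewrite {2}/upd; have [->|_] := eqVneq l k; rewrite ?/upd ?eqxx/=; ring.
- move=> w t; apply: cvgM; first exact: cvg_cst.
  by apply: cvgM; exact: continuous_upd.
- by apply: momentsM => //; exact: moments_coord.
- exact: momentsZ.
Qed.

Definition sqn (w : I -> R) : R := \sum_i w i ^+ 2.

Lemma moments_sqn : moments P (sqn : gsp I R -> R).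
Proof. by apply: moments_sum => i; apply: momentsX; exact: moments_coord. Qed.

(** The variance of a chi-square variable, which is the concentration of the squared norm of the
    signal. *)
Lemma integral_sqn_var :
  \int[P]_w ((sqn w - #|I|%:R) ^+ 2) = 2 * #|I|%:R.
Proof.
have mc i := moments_coord i.
have m2 k l : moments P (fun w => w k ^+ 2 * w l ^+ 2).
  by apply: momentsM; exact: momentsX.
have e1 : \int[P]_w sqn w = #|I|%:R.
  rewrite Rintegral_sum_moments; last by move=> i; exact: momentsX.
  under eq_bigr => i _.
    under eq_Rintegral do rewrite expr2.
    rewrite integral_coord_mul eqxx; over.
  by rewrite sumr_const -mulr_natl mulr1.
have e2 : \int[P]_w (\sum_k \sum_l w k ^+ 2 * w l ^+ 2) = #|I|%:R ^+ 2 + 2 * #|I|%:R.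
  rewrite Rintegral_sum_moments; last by move=> k; exact: moments_sum.
  rewrite (eq_bigr (fun=> #|I|%:R + 2)); last first.
    move=> k _; rewrite Rintegral_sum_moments//.
    rewrite (eq_bigr (fun l => 1 + 2 * (l == k)%:R)); last by move=> l _; exact: integral_coord_sqr_mul.
    rewrite big_split/= sumr_const -mulr_sumr (bigD1 k)//= eqxx big1; last first.
      by move=> l /negbTE ->.
    by rewrite addr0 mulr1.
  by rewrite sumr_const -mulr_natl; ring.
transitivity (\int[P]_w (\sum_k \sum_l w k ^+ 2 * w l ^+ 2 +
    ((- 2 * #|I|%:R) * sqn w + #|I|%:R ^+ 2))).
  apply: eq_Rintegral => w _.
  rewrite (_ : \sum_k \sum_l _ = sqn w * sqn w); first by ring.
  by rewrite /sqn big_distrlr.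
have mS := moments_sqn.
rewrite RintegralD_moments; last 2 first.
- by apply: moments_sum => k; exact: moments_sum.
- by apply: momentsD; [exact: momentsZ|exact: moments_cst].
rewrite RintegralD_moments; [|exact: momentsZ|exact: moments_cst].
by rewrite RintegralZ_moments// Rintegral_cst_probability e1 e2; ring.
Qed.

End coordinates.

(** Stein's identity acts on the signal while the noise [Q] is frozen, so only the first component
    is redrawn. *)
Lemma has_law_upd_fst (I : finType) (R : realType) d (T : measurableType d)
  (Q : probability T R) (i : I) :
  has_law ((gP R (enum I) \x Q) \x @gauss R)%E (gP R (enum I) \x Q)%E
    (fun p => (upd p.1.1 i p.2 : gsp I R, p.1.2)).
Proof.
have mX : measurable_fun setT (fun p : gsp I R * T * R => (upd p.1.1 i p.2 : gsp I R, p.1.2)).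
  apply: measurable_fun_pair.
    apply: measurable_upd; last exact: measurable_snd.
    exact: measurableT_comp measurable_fst measurable_fst.
  exact: measurableT_comp measurable_snd measurable_fst.
apply: has_lawI => // f mf f0.
have mfX := measurableT_comp mf mX.
rewrite (@fubini_tonelli1 _ _ _ _ _ _ _ (fun p : gsp I R * T * R => f (upd p.1.1 i p.2, p.1.2)))//.
rewrite (@fubini_tonelli2 _ _ _ _ _ _ _ f)//.
rewrite (@fubini_tonelli2 _ _ _ _ _ _ _
  (fun q : gsp I R * T => \int[gauss (R:=R)]_t f (upd q.1 i t, q.2))%E)//; last 2 first.
- exact: (measurable_fun_fubini_tonelli_F (fun p : gsp I R * T * R => f (upd p.1.1 i p.2, p.1.2))).
- by move=> q; exact: integral_ge0.
apply: eq_integral => x _; rewrite /fubini_G/=.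
have mfx : measurable_fun setT (fun w : gsp I R => f (w, x)).
  by apply: measurableT_comp => //; exact: pair2_measurable.
rewrite (has_law_ge0_integral (has_law_upd_enum R i) mfx (fun w => f0 _)).
rewrite (@fubini_tonelli1 _ _ _ _ _ _ _ (fun p : gsp I R * R => f (upd p.1 i p.2, x)))//.
exact: measurableT_comp mfx (measurable_upd_pair i).
Qed.

Section overlap.
Variables (R : realType) (d : nat) (al be1 be2 : R).
Notation J := ('I_d * 'I_d + 'I_d + 'I_d)%type.
Notation prior := (gP R (enum 'I_d)).
Notation noise := (gP R (enum [the finType of J])).
Notation m := (prior \x noise)%E.
Notation Th := (gsp 'I_d R).
Notation X := (gsp J R).

(* The data of the model in the variable w = sqrt d u: the matrix, b, and the
   additional observation. *)
Definition sig (j : J) (w : Th) : R :=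
  match j with
  | inl (inl kl) => al * w kl.1 * w kl.2
  | inl (inr l) => be1 * w l
  | inr l => be2 * w l
  end.

Definition dsig (i : 'I_d) (j : J) (w : Th) : R :=
  match j with
  | inl (inl kl) => al * ((kl.1 == i)%:R * w kl.2 + w kl.1 * (kl.2 == i)%:R)
  | inl (inr l) => be1 * (l == i)%:R
  | inr l => be2 * (l == i)%:R
  end.

Let mg (i : 'I_d) : moments prior (fun w => w i). Proof. exact: moments_coord. Qed.

Lemma moments_sig j : moments prior (sig j).
Proof.
case: j => [[kl|l]|l] /=; [|exact: momentsZ..].
by apply: momentsM => //; exact: momentsZ.
Qed.
Let ms := moments_sig.

Lemma moments_dsig i j : moments prior (dsig i j).
Proof.
case: j => [[kl|l]|l] /=; [|exact: moments_cst..].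
apply: momentsZ; apply: momentsD; first exact: momentsZ.
by apply: momentsM => //; exact: moments_cst.
Qed.

Lemma is_derive_sig i j w (t : R) :
  is_derive t (1:R) (fun t => sig j (upd w i t)) (dsig i j (upd w i t)).
Proof.
case: j => [[[k l]|l]|l] /=.
- have h1 := is_derive_upd w i k t; have h2 := is_derive_upd w i l t.
  by apply: is_derive_eq; rewrite /GRing.scale/=; ring.
- have h2 := is_derive_upd w i l t.
  by apply: is_derive_eq; rewrite /GRing.scale/=; ring.
- have h2 := is_derive_upd w i l t.
  by apply: is_derive_eq; rewrite /GRing.scale/=; ring.
Qed.

Lemma continuous_dsig i j w : continuous (fun t => dsig i j (upd w i t)).
Proof.
case: j => [[[k l]|l]|l] t /=; [|exact: cvg_cst..].
apply: cvgM; first exact: cvg_cst.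
by apply: cvgD; apply: cvgM; try exact: cvg_cst; exact: continuous_upd.
Qed.

Notation obs := (observe sig).
Notation "<< p >>" := (post prior sig p) (format "<< p >>").
Notation M i := (post prior sig (fun w => w i)).
Notation B k l := (post prior sig (fun w => w k * w l)).
Notation C k l := (post prior sig (fun w => w k * w k * w l)).

Let mM i : moments m (fun q => M i (obs q)). Proof. exact: (moments_post ms). Qed.
Let mgg k l : moments prior (fun w => w k * w l). Proof. exact: momentsM. Qed.
Let mggg k l : moments prior (fun w => w k * w k * w l). Proof. exact: momentsM. Qed.
Let mB k l : moments m (fun q => B k l (obs q)). Proof. exact: (moments_post ms). Qed.
Let mC k l : moments m (fun q => C k l (obs q)). Proof. exact: (moments_post ms). Qed.
Let mf1 p : moments prior p -> moments m (p \o fst). Proof. exact: moments_fst. Qed.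

Let mg1 k : moments m (fun q => q.1 k). Proof. exact: mf1 (mg k). Qed.

Ltac mom := lazymatch goal with
  | |- moments _ (fun _ => ?c) => exact: moments_cst
  | |- moments _ (fun _ => post _ _ _ _) => apply: (moments_post ms); mom
  | |- moments _ (fun w => w.1 _) => exact: mg1
  | |- moments _ (fun w => w _) => exact: mg
  | |- moments _ (fun _ => _ - _) => apply: momentsB; mom
  | |- moments _ (fun _ => _ + _) => apply: momentsD; mom
  | |- moments _ (fun _ => _ * _) => apply: momentsM; mom
  | |- moments _ (fun _ => _ ^+ _) => apply: momentsX; mom
  | |- moments _ _ => apply: moments_sum => ?; mom
  end.

(** With the noise [x] fixed, varying [w i] moves the observation along the curve with components
    [x j + sig j], to which [is_derive_post] applies. *)
Lemma stein_post i :
  \int[m]_q (q.1 i * M i (obs q)) = \int[m]_q (\sum_j dsig i j q.1 *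
    (post prior sig (fun w => w i * sig j w) (obs q) - M i (obs q) * post prior sig (sig j) (obs q))).
Proof.
apply: (stein (has_law_upd_fst _ i) _ _ _ (mf1 (mg i)) (mM i)).
- by move=> s t; rewrite /= /upd eqxx.
- move=> [w x] t /=.
  apply: (is_derive_post ms (y := fun j t => x j + sig j (upd w i t))
     (y' := fun j t => dsig i j (upd w i t))) => //.
  + move=> j u; have := is_deriveD (is_derive_cst (x j) u 1) (is_derive_sig i j w u).
    by rewrite add0r.
  + by move=> j; exact: continuous_dsig.
- move=> [w x] /=; apply: continuous_bigsum => j t.
  have cp p : moments prior p -> continuous (fun u => post prior sig p (obs (upd w i u : Th, x))).
    move=> mp; apply: (continuous_post ms (y := fun j t => x j + sig j (upd w i t))
     (y' := fun j t => dsig i j (upd w i t))) => //.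
    + move=> k u; have := is_deriveD (is_derive_cst (x k) u 1) (is_derive_sig i k w u).
      by rewrite add0r.
    + by move=> k; exact: continuous_dsig.
  apply: cvgM; first exact: continuous_dsig.
  apply: cvgB; first by apply: cp; exact: momentsM.
  by apply: cvgM; exact: cp.
- apply: moments_sum => j; apply: momentsM; first exact: mf1 (moments_dsig i j).
  apply: momentsB; first by apply: (moments_post ms); exact: momentsM.
  by apply: momentsM => //; exact: (moments_post ms).
Qed.

Lemma sum_delta (F : 'I_d -> R) (l : 'I_d) : \sum_i (l == i)%:R * F i = F l.
Proof.
rewrite (bigD1 l)//= eqxx mul1r big1 ?addr0// => i il.
by rewrite eq_sym (negbTE il) mul0r.
Qed.

Lemma sum_dsig q :
  \sum_i \sum_j dsig i j q.1 *
    (post prior sig (fun w => w i * sig j w) (obs q) - M i (obs q) * post prior sig (sig j) (obs q)) =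
  (be1 ^+ 2 + be2 ^+ 2) * (\sum_l (B l l (obs q) - M l (obs q) * M l (obs q))) +
  2 * al ^+ 2 * (\sum_k \sum_l (q.1 l * C k l (obs q) - q.1 l * (M k (obs q) * B k l (obs q)))).
Proof.
case: q => w x; set y := obs _ => /=.
rewrite exchange_big/= !big_sumType/=.
have E1 (b : R) : \sum_(l : 'I_d) \sum_i b * (l == i)%:R *
   (post prior sig (fun w => w i * (b * w l)) y - M i y * post prior sig (fun w => b * w l) y) =
   b ^+ 2 * \sum_l (B l l y - M l y * M l y).
  rewrite mulr_sumr; apply: eq_bigr => l _.
  under eq_bigr do rewrite -mulrA mulrCA.
  rewrite sum_delta (postZ ms)//.
  rewrite (_ : (fun w => w l * (b * w l)) = (fun w : Th => b * (w l * w l))); last by apply/funext => v; ring.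
  by rewrite (postZ ms)//; ring.
set U := \sum_l (B l l y - M l y * M l y) in E1 *.
set V := (X in _ = _ + _ * X).
transitivity (2 * al ^+ 2 * V + be1 ^+ 2 * U + be2 ^+ 2 * U); last by ring.
congr (_ + _ + _); [|exact: E1|exact: E1].
have E2 k l : \sum_i al * ((k == i)%:R * w l + w k * (l == i)%:R) *
    (post prior sig (fun w => w i * (al * w k * w l)) y -
      M i y * post prior sig (fun w => al * w k * w l) y) =
    al ^+ 2 * (w l * (C k l y - M k y * B k l y)) + al ^+ 2 * (w k * (C l k y - M l y * B l k y)).
  have e i : post prior sig (fun w => w i * (al * w k * w l)) y =
      al * post prior sig (fun w => w i * w k * w l) y.
    by rewrite -(postZ ms); [congr post; apply/funext => v; ring|apply: momentsM].
  have e' : post prior sig (fun w => al * w k * w l) y = al * B k l y.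
    by rewrite -(postZ ms)//; congr post; apply/funext => v; ring.
  under eq_bigr => i _.
    rewrite e e' (_ : _ * _ * _ =
      (k == i)%:R * (al * w l * (al * post prior sig (fun w => w i * w k * w l) y - M i y * (al * B k l y))) +
      (l == i)%:R * (al * w k * (al * post prior sig (fun w => w i * w k * w l) y - M i y * (al * B k l y)))); last by ring.
    over.
  rewrite big_split/= !sum_delta.
  rewrite (_ : (fun w => w l * w k * w l) = (fun w : Th => w l * w l * w k)); last by apply/funext => v; ring.
  rewrite (_ : B l k y = B k l y); last by congr post; apply/funext => v; ring.
  ring.
transitivity (\sum_k \sum_l (al ^+ 2 * (w l * (C k l y - M k y * B k l y)) +
    al ^+ 2 * (w k * (C l k y - M l y * B l k y)))).
  by rewrite [RHS]pair_bigA; apply: eq_bigr => -[k l] _; exact: E2.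
under eq_bigr do rewrite big_split/=.
(* Exchanging [k] and [l] makes the two halves of the derivative of [w k * w l] equal, whence the
   factor 2. *)
rewrite big_split/= [X in _ + X]exchange_big/=; set A := \sum_k _.
suff -> : A = al ^+ 2 * V by ring.
rewrite mulr_sumr; apply: eq_bigr => k _.
by rewrite mulr_sumr; apply: eq_bigr => l _; ring.
Qed.

(** In the scale of [w], this is [d] times the mean-square overlap of [u] with its posterior
    mean. *)
Definition ovl : R := \int[m]_q (\sum_i M i (obs q) ^+ 2).

(** The scalar product of the signal with its posterior mean; by the tower property its mean is
    [ovl]. *)
Let S (q : Th * X) : R := \sum_i q.1 i * M i (obs q).
Let N (q : Th * X) : R := sqn q.1.

Let mS : moments m S.
Proof. rewrite /S; mom. Qed.
Let mN : moments m N.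
Proof. exact: mf1 (moments_sqn _ _). Qed.
Let mM2 : moments m (fun q => \sum_i M i (obs q) ^+ 2).
Proof. mom. Qed.

Let tow p (F : X -> R) : moments prior p -> measurable_fun setT F -> moments m (F \o obs) ->
  \int[m]_q (p q.1 * F (obs q)) = \int[m]_q (post prior sig p (obs q) * F (obs q)).
Proof. exact: (tower ms). Qed.
Let mpo p : moments prior p -> measurable_fun setT (post prior sig p : X -> R).
Proof. exact: (measurable_post ms). Qed.

Lemma ovlE : ovl = \int[m]_q S q.
Proof.
rewrite /ovl /S !Rintegral_sum_moments; last 2 first.
- by move=> i; mom.
- by move=> i; mom.
by apply: eq_bigr => i _; rewrite (tow (mg i) (mpo (mg i)) (mM i)).
Qed.

Lemma integral_post p : moments prior p ->
  \int[m]_q post prior sig p (obs q) = \int[prior]_w p w.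
Proof.
move=> mp; have := tow mp (@measurable_cst _ _ X R setT 1) (moments_cst m 1).
under eq_Rintegral do rewrite mulr1.
under [in X in _ = X -> _]eq_Rintegral do rewrite mulr1.
move=> <-; apply/esym.
exact: (has_law_Rintegral (has_law_fst prior _) (moments_measurable mp)).
Qed.

(** Stein's identity summed over the coordinates. [tower] then rewrites the products of signal
    coordinates and posterior averages so that they assemble into [N * S] and [S ^+ 2]. *)
Lemma ovl_identity : ovl = (be1 ^+ 2 + be2 ^+ 2) * (d%:R - ovl) +
  2 * al ^+ 2 * (\int[m]_q (N q * S q) - \int[m]_q (S q ^+ 2)).
Proof.
rewrite {1}ovlE /S Rintegral_sum_moments; last by move=> i; mom.
under eq_bigr do rewrite stein_post.
rewrite -Rintegral_sum_moments; last first.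
  move=> i; apply: moments_sum => j; apply: momentsM; first exact: mf1 (moments_dsig i j).
  apply: momentsB; first by apply: (moments_post ms); exact: momentsM.
  by apply: momentsM => //; exact: (moments_post ms).
under eq_Rintegral do rewrite sum_dsig.
rewrite RintegralD_moments; last 2 first.
- mom.
- mom.
rewrite !RintegralZ_moments; [|mom..].
congr (_ * _ + _ * _).
  rewrite /ovl !Rintegral_sum_moments; [|by move=> i; mom..].
  rewrite (_ : d%:R = \sum_(i < d) 1 :> R); last by rewrite sumr_const card_ord.
  rewrite -sumrB; apply: eq_bigr => l _; rewrite RintegralB_moments; [|mom..].
  under [X in _ = _ - X]eq_Rintegral do rewrite expr2.
  by rewrite integral_post// integral_coord_mul eqxx.
have eqB (a b a' b' : R) : a = a' -> b = b' -> a - b = a' - b' by move=> -> ->.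
transitivity (\sum_k \sum_l (\int[m]_q (q.1 k * q.1 k * q.1 l * M l (obs q)) -
    \int[m]_q (q.1 k * q.1 l * (M k (obs q) * M l (obs q))))).
  rewrite Rintegral_sum_moments; last by move=> k; mom.
  apply: eq_bigr => k _; rewrite Rintegral_sum_moments; last by move=> l; mom.
  apply: eq_bigr => l _; rewrite RintegralB_moments; last 2 first.
  - exact: (momentsM (mf1 (mg l)) (mC k l)).
  - by apply: (momentsM (mf1 (mg l))); mom.
  (* [tower] is used in both directions: it replaces [w l] by its posterior mean, then turns a
     higher posterior moment back into signal coordinates. *)
  apply: eqB.
    rewrite (tow (mg l) (mpo (mggg k l)) (mC k l)) [RHS](tow (mggg k l) (mpo (mg l)) (mM l)).
    by apply: eq_Rintegral => q _; rewrite mulrC.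
  have mb : measurable_fun setT (fun x : X => M k x * B k l x).
    by apply: measurable_funM; exact: mpo.
  have mb' : measurable_fun setT (fun x : X => M k x * M l x).
    by apply: measurable_funM; exact: mpo.
  rewrite (tow (mg l) mb) ?[RHS](tow (mgg k l) mb'); [|rewrite /comp; mom..].
  by apply: eq_Rintegral => q _; ring.
under eq_bigr do rewrite sumrB; rewrite sumrB; congr (_ - _).
  transitivity (\int[m]_q (\sum_k \sum_l q.1 k * q.1 k * q.1 l * M l (obs q))).
    rewrite Rintegral_sum_moments; last by move=> k; mom.
    by apply: eq_bigr => k _; rewrite Rintegral_sum_moments// => l; mom.
  apply: eq_Rintegral => q _; rewrite /N /sqn /S big_distrlr/=.
  by apply: eq_bigr => k _; apply: eq_bigr => l _; ring.
transitivity (\int[m]_q (\sum_k \sum_l q.1 k * q.1 l * (M k (obs q) * M l (obs q)))).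
  rewrite Rintegral_sum_moments; last by move=> k; mom.
  by apply: eq_bigr => k _; rewrite Rintegral_sum_moments// => l; mom.
apply: eq_Rintegral => q _; rewrite expr2 /S big_distrlr/=.
by apply: eq_bigr => k _; apply: eq_bigr => l _; ring.
Qed.

Lemma ovl_ge0 : 0 <= ovl.
Proof. by apply: Rintegral_ge0 => q _; apply: sumr_ge0 => i _; exact: sqr_ge0. Qed.

Lemma ovl_le : ovl <= d%:R.
Proof.
rewrite (_ : d%:R = \int[m]_q (\sum_i B i i (obs q))); last first.
  rewrite Rintegral_sum_moments; last by move=> i; mom.
  under eq_bigr do rewrite integral_post// integral_coord_mul eqxx.
  by rewrite sumr_const card_ord.
apply: le_Rintegral_moments; [exact: mM2|mom|].
move=> q; apply: ler_sum => i _.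
exact: (post_sqr_le ms (obs q) (mg i)).
Qed.

(** Only [N * S] has to be decoupled: the deviation of [N] from [d], of variance [2 * d], is charged
    at the price [1 / (4 * eta)], which gives [d / (2 * eta)]. *)
Lemma ovl_quadratic (eta : R) : 0 < eta <= 1 ->
  ovl <= (be1 ^+ 2 + be2 ^+ 2) * (d%:R - ovl) +
    2 * al ^+ 2 * (d%:R * ovl - (1 - eta) * ovl ^+ 2 + d%:R / (2 * eta)).
Proof.
move=> /andP[eta0 eta1]; rewrite {1}ovl_identity lerD2l ler_wpM2l//.
  by rewrite mulr_ge0// sqr_ge0.
have mNS : moments m (fun q => N q * S q) by exact: momentsM mN mS.
have mS2 : moments m (fun q => S q ^+ 2) by exact: momentsX mS.
have mNd : moments m (fun q => (N q - d%:R) ^+ 2).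
  by apply: momentsX; apply: momentsB => //; exact: moments_cst.
rewrite -RintegralB_moments//.
have eN : \int[m]_q ((N q - d%:R) ^+ 2) = 2 * d%:R.
  rewrite -[in RHS](card_ord d) -(@integral_sqn_var 'I_d R) card_ord.
  rewrite [RHS](has_law_Rintegral (has_law_fst prior [the finType of J]))//.
  apply: measurable_funX; apply: measurable_funB => //.
  exact: moments_measurable (moments_sqn _ _).
have mb : moments m (fun q => (1 / (4 * eta)) * (N q - d%:R) ^+ 2 +
    ((d%:R - 2 * (1 - eta) * ovl) * S q + (1 - eta) * ovl ^+ 2)).
  apply: momentsD; first exact: momentsZ.
  by apply: momentsD; [exact: momentsZ|exact: moments_cst].
apply: le_trans (le_Rintegral_moments (momentsB mNS mS2) mb _) _.
  move=> q; set s := S q; set v := N q - d%:R.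
  have -> : N q = v + d%:R by rewrite subrK.
  (* After integration this is Jensen's bound for the share [1 - eta] of [S ^+ 2]. The remaining
     share [eta] pays for the correlation of [N] and [S] in [h2]. *)
  have h1 : 0 <= (1 - eta) * (s - ovl) ^+ 2 by rewrite mulr_ge0 ?sqr_ge0// subr_ge0.
  have h2 : v * s <= 1 / (4 * eta) * v ^+ 2 + eta * s ^+ 2.
    rewrite -subr_ge0 (_ : _ - _ = eta * (s - v / (2 * eta)) ^+ 2).
      by rewrite mulr_ge0 ?sqr_ge0// ltW.
    by field; rewrite gt_eqF.
  nra.
rewrite RintegralD_moments; [|exact: momentsZ|by apply: momentsD; [exact: momentsZ|exact: moments_cst]].
rewrite RintegralD_moments; [|exact: momentsZ|exact: moments_cst].
rewrite Rintegral_cst_probability !RintegralZ_moments// eN -ovlE.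
rewrite le_eqVlt; apply/orP; left; apply/eqP; field.
by rewrite gt_eqF.
Qed.

End overlap.

(** * The effect of an additional observation *)

(* No measurability is assumed: the supremum defining [best_overlap] is only
   ever bounded from above by a measurable function. *)
Lemma ge0_le_integral_nonmeasurable d (T : measurableType d) (R : realType)
    (mu : {measure set T -> \bar R}) (f g : T -> \bar R) :
  (forall x, (0 <= f x)%E) -> (forall x, (f x <= g x)%E) ->
  (\int[mu]_x f x <= \int[mu]_x g x)%E.
Proof.
move=> f0 fg; have g0 x : (0 <= g x)%E by exact: le_trans (fg x).
rewrite !ge0_integralTE//; apply: ge_ereal_sup => _ [h /= hf <-].
by apply: ereal_sup_ubound; exists h => // x; exact: le_trans (fg x).
Qed.

(** * Iterated Gaussian expectations over sums of index types *)

Section gauss_iter_lemmas.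
Variable R : realType.

Lemma gauss_iter_ge0 (I : eqType) s (f : (I -> R) -> \bar R) v :
  (forall v, (0 <= f v)%E) -> (0 <= gauss_iter s f v)%E.
Proof.
move=> f0; elim: s v => [|i s IH] v //=.
by apply: integral_ge0 => x _; exact: IH.
Qed.

Lemma le_gauss_exp (I : finType) (f g : (I -> R) -> \bar R) :
  (forall v, (0 <= f v)%E) -> (forall v, (f v <= g v)%E) ->
  (gauss_exp f <= gauss_exp g)%E.
Proof.
move=> f0 fg; rewrite /gauss_exp; move: (fun=> 0) => v.
elim: (enum I) v => [|i s IH] v //=.
apply: ge0_le_integral_nonmeasurable => x; last exact: IH.
exact: gauss_iter_ge0.
Qed.

Lemma gauss_iter_cat (I : eqType) s1 s2 (f : (I -> R) -> \bar R) v :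
  gauss_iter (s1 ++ s2) f v = gauss_iter s1 (gauss_iter s2 f) v.
Proof.
by elim: s1 v => [|i s IH] v //=; apply: eq_integral => x _; exact: IH.
Qed.

Lemma gauss_expE (I : finType) (f : gsp I R -> \bar R) :
  measurable_fun setT f -> (forall w, (0 <= f w)%E) ->
  gauss_exp f = (\int[gP R (enum I)]_w f w)%E.
Proof.
move=> mf f0; rewrite /gauss_exp gauss_iterE ?enum_uniq//.
apply: eq_integral => w _; congr f; apply/funext => i.
by rewrite /override mem_enum.
Qed.

Lemma eq_gauss_exp (I : finType) (f g : (I -> R) -> \bar R) :
  (forall w, f w = g w) -> gauss_exp f = gauss_exp g.
Proof. by move=> /funext ->. Qed.

Section sum.
Variables A B : finType.

Definition sumf (a : A -> R) (b : B -> R) : A + B -> R :=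
  fun j => match j with inl i => a i | inr i => b i end.

Lemma measurable_sumf d (T : measurableType d) (f : T -> gsp A R) (g : T -> gsp B R) :
  measurable_fun setT f -> measurable_fun setT g ->
  measurable_fun setT (fun t => sumf (f t) (g t) : gsp (A + B)%type R).
Proof.
by move=> mf mg; apply: measurable_gsp => -[i|i] /=; exact: measurable_gsp_comp.
Qed.

Lemma gauss_iter_inl s f a b :
  gauss_iter (map inl s) f (sumf a b) = gauss_iter s (fun a' => f (sumf a' b)) a.
Proof.
elim: s a => [|i s IH] a //=; apply: eq_integral => x _.
by rewrite -IH; congr gauss_iter; apply/funext => -[j|j].
Qed.

Lemma gauss_iter_inr s f a b :
  gauss_iter (map inr s) f (sumf a b) = gauss_iter s (fun b' => f (sumf a b')) b.
Proof.
elim: s b => [|i s IH] b //=; apply: eq_integral => x _.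
by rewrite -IH; congr gauss_iter; apply/funext => -[j|j].
Qed.

Lemma enum_sumE : enum {: A + B} = map inl (enum A) ++ map inr (enum B).
Proof. by rewrite !enumT [in LHS]unlock. Qed.

Lemma gauss_exp_sum (f : (A + B -> R) -> \bar R) :
  gauss_exp f = gauss_exp (fun a => gauss_exp (fun b => f (sumf a b))).
Proof.
rewrite {1}/gauss_exp enum_sumE gauss_iter_cat.
rewrite (_ : (fun=> 0) = sumf (fun=> 0) (fun=> 0)); last by apply/funext => -[j|j].
rewrite gauss_iter_inl; apply: (@eq_gauss_exp A) => a; exact: gauss_iter_inr.
Qed.

Lemma ge0_integral_gP_sum (F : gsp (A + B)%type R -> \bar R) :
  measurable_fun setT F -> (forall w, (0 <= F w)%E) ->
  (\int[gP R (enum {: A + B})]_w F w =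
   \int[gP R (enum A)]_a \int[gP R (enum B)]_b F (sumf a b))%E.
Proof.
move=> mF F0; rewrite -(gauss_expE mF F0) gauss_exp_sum.
have mp : measurable_fun setT (fun p : gsp A R * gsp B R => F (sumf p.1 p.2)).
  apply: (measurableT_comp mF); apply: measurable_sumf.
    exact: measurable_fst.
  exact: measurable_snd.
have mI : measurable_fun setT (fun a : gsp A R => \int[gP R (enum B)]_b F (sumf a b))%E.
  exact: (measurable_fun_fubini_tonelli_F (fun p : gsp A R * gsp B R => F (sumf p.1 p.2))).
rewrite -(gauss_expE mI); last by move=> a; exact: integral_ge0.
apply: eq_gauss_exp => a; apply: gauss_expE => //.
apply: (measurableT_comp mF).
by apply: (@measurable_sumf _ _ (fun=> a) id); [exact: measurable_cst|exact: measurable_id].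
Qed.

End sum.
End gauss_iter_lemmas.

Section one_step.
Variables (R : realType) (d : nat) (al be1 be2 : R).
Hypothesis be2_neq0 : be2 != 0.
Notation J0 := ('I_d * 'I_d + 'I_d)%type.
Notation J := ('I_d * 'I_d + 'I_d + 'I_d)%type.
Notation prior := (gP R (enum 'I_d)).
Notation Th := (gsp 'I_d R).
Notation sg := (sig al be1 be2).
Let sig0 (j : J0) (w : Th) : R := sg (inl j) w.
Let sigk (l : 'I_d) (w : Th) : R := sg (inr l) w.

Let mg (i : 'I_d) : moments prior (fun w => w i). Proof. exact: moments_coord. Qed.
Let ms j : moments prior (sg j). Proof. exact: moments_sig. Qed.
Let ms0 j : moments prior (sig0 j). Proof. exact: ms. Qed.
Let msk j : moments prior (sigk j). Proof. exact: ms. Qed.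

Lemma lik_ratio_sumf (x : J0 -> R) (k : 'I_d -> R) w :
  lik_ratio sg (sumf x k) w = lik_ratio sig0 x w * lik_ratio sigk k w.
Proof. by rewrite /lik_ratio -expRD big_sumType. Qed.

(** Cameron-Martin for the extra channel alone, with [x] fixed: drawing [k] from pure noise and
    weighting by its likelihood amounts to drawing it from the channel with signal [w]. *)
Lemma ge0_integral_upost_sumf (p : Th * Th -> R) (x : J0 -> R) :
  measurable_fun setT p -> (forall q, 0 <= p q) ->
  (forall k : Th, moments prior (fun w => p (w, k))) ->
  (\int[gP R (enum 'I_d)]_k (upost prior sg (fun w => p (w, k)) (sumf x k))%:E =
   \int[prior]_w ((lik_ratio sig0 x w)%:E *
     \int[gP R (enum 'I_d)]_k (p (w, observe sigk (w, k)))%:E))%E.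
Proof.
move=> mp p0 mpk.
have mL0 : measurable_fun setT (fun q : Th * Th => lik_ratio sig0 x q.1).
  by apply: (measurable_lik_ratio ms0); [exact: measurable_cst|exact: measurable_fst].
have mF : measurable_fun setT (fun q : Th * Th => (p q * lik_ratio sig0 x q.1)%:E).
  by apply/measurable_EFinP; exact: measurable_funM.
have F0 q : (0 <= (p q * lik_ratio sig0 x q.1)%:E)%E by rewrite lee_fin mulr_ge0// lik_ratio_ge0.
have mpo : measurable_fun setT (fun q : Th * Th => p (q.1, observe sigk q)).
  exact: measurableT_comp mp (measurable_joint msk).
transitivity (\int[prior \x gP R (enum 'I_d)]_q
    ((p q * lik_ratio sig0 x q.1)%:E * (lik_ratio sigk q.2 q.1)%:E))%E.
  rewrite fubini_tonelli2; last 2 first.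
  - apply: emeasurable_funM => //; apply/measurable_EFinP; exact: measurable_lik_pair.
  - by move=> q; rewrite mule_ge0// lee_fin lik_ratio_ge0.
  apply: eq_integral => k _; rewrite /fubini_G/= -(EFin_upost ms _ (mpk k)).
  by apply: eq_integral => w _; rewrite lik_ratio_sumf mulrA EFinM.
rewrite -(ge0_bayes msk mF F0)/= fubini_tonelli1; last 2 first.
- by apply/measurable_EFinP; apply: measurable_funM.
- by move=> q; exact: (F0 (q.1, observe sigk q)).
apply: eq_integral => w _; rewrite /fubini_F/= -ge0_integralZl//.
- by apply: eq_integral => k _; rewrite -EFinM mulrC.
- by apply/measurable_EFinP; exact: measurableT_comp mpo (pair1_measurable w).
- by move=> k _; rewrite lee_fin.
- by rewrite lee_fin lik_ratio_ge0.
Qed.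

(** The squared norm of the posterior mean of [w] multiplied by the evidence, the form in which it
    is integrated against pure noise. *)
Definition upost_sqr (x : J -> R) : R :=
  \sum_i upost prior sg (fun w => w i) x ^+ 2 / evidence prior sg x.

Lemma upost_sqr_ge0 x : 0 <= upost_sqr x.
Proof.
by apply: sumr_ge0 => i _; rewrite divr_ge0 ?sqr_ge0// ltW// evidence_gt0.
Qed.

Lemma measurable_upost_sqr : measurable_fun setT (upost_sqr : gsp J R -> R).
Proof.
have -> : upost_sqr = (fun x => \sum_i post prior sg (fun w => w i) x * upost prior sg (fun w => w i) x).
  by apply/funext => x; apply: eq_bigr => i _; rewrite /post; ring.
apply: measurable_sum => i; apply: measurable_funM.
  exact: (measurable_post ms).
exact: (measurable_upost ms).
Qed.

(** The posterior mean minimises the mean-square error, here multiplied by the evidence [Z]: the two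
    sides differ by a sum of squares divided by [Z]. *)
Lemma upost_sqn_le (x : J -> R) (c : 'I_d -> R) :
  upost prior sg (@sqn _ R) x <= upost_sqr x + upost prior sg (fun w => \sum_i (w i - c i) ^+ 2) x.
Proof.
have mc i : moments prior (fun w => w i * w i) by exact: momentsM.
have Z0 := evidence_gt0 ms x; set Z := evidence _ _ _ in Z0 *.
rewrite (_ : (fun w => _) = (fun w : Th => sqn w + \sum_i ((- 2 * c i) * w i + c i ^+ 2))); last first.
  by apply/funext => w; rewrite /sqn -big_split; apply: eq_bigr => i _ /=; ring.
have mi i : moments prior (fun w => (- 2 * c i) * w i + c i ^+ 2).
  by apply: momentsD; [exact: momentsZ|exact: moments_cst].
rewrite (upostD ms); [|exact: moments_sqn|exact: moments_sum].
rewrite addrCA lerDl.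
have -> : upost prior sg (fun w => \sum_i (- 2 * c i * w i + c i ^+ 2)) x =
    \sum_i (- 2 * c i * upost prior sg (fun w => w i) x + c i ^+ 2 * Z).
  rewrite (upostE ms) (post_sum ms)// mulr_suml; apply: eq_bigr => i _.
  rewrite -(upostE ms) (upostD ms); [|exact: momentsZ|exact: moments_cst].
  by rewrite (upostZ ms)// (upost_cst ms).
rewrite /upost_sqr -/Z -big_split; apply: sumr_ge0 => i _ /=.
set n := upost _ _ _ _.
rewrite (_ : _ + _ = (n - c i * Z) ^+ 2 / Z); last by field; rewrite gt_eqF.
by rewrite divr_ge0 ?sqr_ge0// ltW.
Qed.

Lemma integral_dot_sqr (v : 'I_d -> R) : \sum_i v i ^+ 2 = 1 ->
  (\int[prior]_k ((\sum_i v i * k i) ^+ 2)%:E = 1)%E.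
Proof.
move=> v1; have mv : moments prior (fun k => \sum_i v i * k i).
  by apply: moments_sum => i; exact: momentsZ.
rewrite EFin_Rintegral_moments; last exact: momentsX.
congr EFin.
transitivity (\int[prior]_k (\sum_i \sum_j (v i * v j) * (k i * k j))).
  apply: eq_Rintegral => k _; rewrite expr2 big_distrlr/=.
  by apply: eq_bigr => i _; apply: eq_bigr => j _; ring.
have mm i j : moments prior (fun k => (v i * v j) * (k i * k j)).
  by apply: momentsZ; exact: momentsM.
rewrite Rintegral_sum_moments; last by move=> i; exact: moments_sum.
rewrite -[RHS]v1; apply: eq_bigr => i _; rewrite Rintegral_sum_moments//.
rewrite (bigD1 i)//= big1 => [|j ji].
  by rewrite RintegralZ_moments ?integral_coord_mul ?eqxx ?addr0 ?mulr1//; exact: momentsM.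
rewrite RintegralZ_moments ?integral_coord_mul ?(negbTE ji) ?mulr0//; exact: momentsM.
Qed.

Lemma one_step (x : J0 -> R) (v : 'I_d -> R) : \sum_i v i ^+ 2 = 1 ->
  ((upost prior sig0 (fun w => (\sum_i v i * w i) ^+ 2) x)%:E <=
    \int[prior]_k (upost_sqr (sumf x k))%:E + (evidence prior sig0 x / be2 ^+ 2)%:E)%E.
Proof.
move=> v1.
pose D (w : Th) := \sum_i v i * w i.
have mD : moments prior D by apply: moments_sum => i; exact: momentsZ.
have mD2 : moments prior (fun w => D w ^+ 2) by exact: momentsX.
have mN : moments prior (@sqn _ R) by exact: moments_sqn.
(* The squared error of the estimator [v (v.k) / be2]. For [k = be2 w + noise] it recovers the
   component of [w] along [v] up to noise and nothing else, which is [pE]. *)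
pose p (q : Th * Th) := \sum_i (q.1 i - v i * D q.2 / be2) ^+ 2.
have mco (i : 'I_d) : measurable_fun setT (fun q : Th * Th => q.1 i).
  exact: measurable_gsp_comp measurable_fst.
have mp : measurable_fun setT p.
  apply: measurable_sum => i; apply: measurable_funX; apply: measurable_funB => //.
  apply: measurable_funM => //; apply: measurable_funM => //.
  exact: measurableT_comp (moments_measurable mD) measurable_snd.
have p0 q : 0 <= p q by apply: sumr_ge0 => i _; exact: sqr_ge0.
have mpk (k : Th) : moments prior (fun w => p (w, k)).
  apply: moments_sum => i; apply: momentsX; apply: momentsB => //.
  exact: (moments_cst _ (v i * D k / be2)).
have mNf : measurable_fun setT (fun q : Th * Th => sqn q.1).
  exact: measurableT_comp (moments_measurable mN) measurable_fst.
have N0 (w : Th) : 0 <= sqn w by apply: sumr_ge0 => i _; exact: sqr_ge0.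
have e1 := ge0_integral_upost_sumf x mNf (fun q => N0 q.1) (fun _ => mN).
have e2 := ge0_integral_upost_sumf x mp p0 mpk.
have pE w k : p (w, observe sigk (w, k)) = sqn w - D w ^+ 2 + D k ^+ 2 / be2 ^+ 2.
  have DE : D (observe sigk (w, k)) = D k + be2 * D w.
    rewrite /D /observe /sigk/= mulr_sumr -big_split; apply: eq_bigr => i _ /=; ring.
  rewrite /p /= DE.
  transitivity (\sum_i (w i ^+ 2 - 2 * ((D k + be2 * D w) / be2) * (v i * w i) +
      ((D k + be2 * D w) / be2) ^+ 2 * v i ^+ 2)).
    by apply: eq_bigr => i _; ring.
  rewrite big_split/= sumrB -!mulr_sumr v1 -/(D w) -/(sqn w).
  by field.
have ip w : (\int[gP R (enum 'I_d)]_k (p (w, observe sigk (w, k)))%:E =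
    (sqn w - D w ^+ 2 + (be2 ^+ 2)^-1)%:E)%E.
  under eq_integral do rewrite pE.
  have mm : moments prior (fun k => D k ^+ 2 / be2 ^+ 2) by apply: momentsM => //; exact: moments_cst.
  rewrite EFin_Rintegral_moments; last by apply: momentsD => //; exact: moments_cst.
  congr EFin; rewrite RintegralD_moments//; last exact: moments_cst.
  rewrite Rintegral_cst_probability; congr (_ + _).
  under eq_Rintegral do rewrite mulrC.
  rewrite RintegralZ_moments// -[RHS]mulr1; congr (_ * _).
  by apply: EFin_inj; rewrite -(EFin_Rintegral_moments mD2) integral_dot_sqr.
have i1 : (\int[prior]_w ((lik_ratio sig0 x w)%:E *
     \int[gP R (enum 'I_d)]_k (sqn w)%:E))%E = (upost prior sig0 (@sqn _ R) x)%:E.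
  rewrite -(EFin_upost ms0 _ mN); apply: eq_integral => w _.
  by rewrite (integral_cst_probability prior) -EFinM mulrC.
have mNDe : moments prior (fun w => sqn w - D w ^+ 2 + (be2 ^+ 2)^-1).
  by apply: momentsD; [exact: momentsB|exact: moments_cst].
have i2 : (\int[prior]_w ((lik_ratio sig0 x w)%:E *
     \int[gP R (enum 'I_d)]_k (p (w, observe sigk (w, k)))%:E))%E =
     (upost prior sig0 (@sqn _ R) x - upost prior sig0 (fun w => D w ^+ 2) x +
      evidence prior sig0 x / be2 ^+ 2)%:E.
  transitivity ((upost prior sig0 (fun w => sqn w - D w ^+ 2 + (be2 ^+ 2)^-1) x)%:E).
    rewrite -(EFin_upost ms0 _ mNDe); apply: eq_integral => w _.
    by rewrite ip -EFinM mulrC.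
  congr EFin; rewrite (upostD ms0); [|exact: momentsB|exact: moments_cst].
  rewrite (upost_cst ms0) mulrC; congr (_ + _).
  rewrite !(upostE ms0) (postB ms0)// mulrBl//.
have mu1 (f : Th -> R) : moments prior f ->
    measurable_fun setT (fun k : Th => (upost prior sg f (sumf x k))%:E).
  move=> mf; apply/measurable_EFinP; apply: (measurableT_comp (measurable_upost ms mf)).
  by apply: (@measurable_sumf _ _ _ _ _ (fun=> x) id); [exact: measurable_cst|exact: measurable_id].
have mus : measurable_fun setT (fun k : Th => (upost_sqr (sumf x k))%:E).
  apply/measurable_EFinP; apply: (measurableT_comp measurable_upost_sqr).
  by apply: (@measurable_sumf _ _ _ _ _ (fun=> x) id); [exact: measurable_cst|exact: measurable_id].
pose h (q : Th * Th) : \bar R := (p q * lik_ratio sg (sumf x q.2) q.1)%:E.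
have mh : measurable_fun setT h.
  apply/measurable_EFinP; apply: measurable_funM => //.
  apply: (measurable_lik_ratio ms); last exact: measurable_fst.
  by apply: (@measurable_sumf _ _ _ _ _ (fun=> x) snd); [exact: measurable_cst|exact: measurable_snd].
have h0 q : (0 <= h q)%E by rewrite lee_fin mulr_ge0// lik_ratio_ge0.
have mup' : measurable_fun setT (fubini_G prior h).
  exact: measurable_fun_fubini_tonelli_G.
have mup : measurable_fun setT (fun k : Th => (upost prior sg (fun w => p (w, k)) (sumf x k))%:E).
  by apply: eq_measurable_fun mup' => k _; exact: (EFin_upost ms (sumf x k) (mpk k)).
have hle : (\int[prior]_k (upost prior sg (fun w => sqn (w, k).1) (sumf x k))%:E <=
   \int[prior]_k (upost_sqr (sumf x k))%:E +
   \int[prior]_k (upost prior sg (fun w => p (w, k)) (sumf x k))%:E)%E.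
  rewrite -ge0_integralD//; last 2 first.
  - by move=> k _; rewrite lee_fin upost_sqr_ge0.
  - by move=> k _; rewrite lee_fin upost_ge0.
  apply: ge0_le_integral => //.
  - by move=> k _; rewrite lee_fin upost_ge0.
  - exact: mu1.
  - exact: emeasurable_funD.
  - by move=> k _; rewrite -EFinD lee_fin; exact: (upost_sqn_le (sumf x k) (fun i => v i * D k / be2)).
(* [B] could a priori be infinite, so the common term [r], which comes from the squared norm of [w],
   is cancelled by cases. *)
have aux (A B C : \bar R) (r s t : R) : (A <= B + C)%E -> A = r%:E ->
    C = (r - s + t)%:E -> (s%:E <= B + t%:E)%E.
  move=> ABC Ar Cr; move: ABC; rewrite {}Ar {}Cr.
  case: B => [b| |] //= hB; last by rewrite leey.
  by move: hB; rewrite -!EFinD !lee_fin; lra.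
exact: aux hle (etrans e1 i1) (etrans e2 i2).
Qed.

End one_step.

(** * From the spiked matrix model to the channel *)

Section reduction.
Variables (R : realType) (lam tau0 delta : R) (d : nat).
Hypotheses (d_gt0 : (0 < d)%N) (tau0_ge0 : 0 <= tau0) (delta_gt0 : 0 < delta).
Notation J0 := ('I_d * 'I_d + 'I_d)%type.
Notation J := ('I_d * 'I_d + 'I_d + 'I_d)%type.
Notation prior := (gP R (enum 'I_d)).
Notation Th := (gsp 'I_d R).
Notation D := (d%:R : R).
Let r : R := Num.sqrt (2 * D).
Let s : R := Num.sqrt D.
(** Chosen so that adding the transpose to [G + al w w^T] and dividing by [r] gives
    [lam u u^T + W]. *)
Let al : R := lam * r / (2 * D).
Let be1 : R := Num.sqrt tau0.
Let be2 : R := Num.sqrt delta.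
Notation sg := (sig al be1 be2).
Let sg0 (j : J0) (w : Th) : R := sg (inl j) w.

Let D0 : 0 < D. Proof. by rewrite ltr0n. Qed.
Let D_neq0 : D != 0. Proof. by rewrite gt_eqF. Qed.
Let r2 : r ^+ 2 = 2 * D. Proof. by rewrite sqr_sqrtr// mulr_ge0// ltW. Qed.
Let s2 : s ^+ 2 = D. Proof. by rewrite sqr_sqrtr// ltW. Qed.
Let r_neq0 : r != 0. Proof. by rewrite gt_eqF// sqrtr_gt0 mulr_gt0. Qed.
Let s_neq0 : s != 0. Proof. by rewrite gt_eqF// sqrtr_gt0. Qed.
Let alE : al = lam / r.
Proof. by rewrite /al -r2; field. Qed.
Let al2 : al ^+ 2 = lam ^+ 2 / (2 * D).
Proof. by rewrite alE expr_div_n r2. Qed.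
Let be1_2 : be1 ^+ 2 = tau0. Proof. exact: sqr_sqrtr. Qed.
Let be2_2 : be2 ^+ 2 = delta. Proof. by rewrite sqr_sqrtr// ltW. Qed.
Let be2_neq0 : be2 != 0. Proof. by rewrite gt_eqF// sqrtr_gt0. Qed.

Let mg (i : 'I_d) : moments prior (fun w => w i). Proof. exact: moments_coord. Qed.
Let ms j : moments prior (sg j). Proof. exact: moments_sig. Qed.
Let ms0 j : moments prior (sg0 j). Proof. exact: ms. Qed.

(* [Mof] and [bof] recover (M, b) from the channel output, of which the matrix part
   is not symmetric; the antisymmetric part is independent of u and drops out. *)
Definition Mof (x : J0 -> R) (i j : 'I_d) : R := (x (inl (i, j)) + x (inl (j, i))) / r.
Definition bof (x : J0 -> R) (i : 'I_d) : R := x (inr i) / s.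
Let C (x : J0 -> R) : R :=
  expR (- (D / 4) * (\sum_i \sum_j Mof x i j ^+ 2) - (D / 2) * (\sum_i bof x i ^+ 2)).

(** When the squares are expanded, the terms free of [g] form [C x], which cancels in the posterior
    quotient. Only the symmetric part of the matrix pairs with [g i * g j]. *)
Lemma likE (x : J0 -> R) (g : 'I_d -> R) :
  lik lam tau0 (Mof x) (bof x) (fun i => g i / s) = C x * lik_ratio sg0 x g.
Proof.
rewrite /lik /C /lik_ratio -expRD; congr expR.
pose T := \sum_i \sum_j x (inl (i, j)) * (g i * g j).
pose V := \sum_i \sum_j (g i * g j) ^+ 2.
pose X := \sum_i x (inr i) * g i.
pose G := \sum_i g i ^+ 2.
have MT : \sum_i \sum_j Mof x i j * (g i * g j) = 2 / r * T.
  have h : \sum_i \sum_j x (inl (j, i)) * (g i * g j) = T.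
    rewrite exchange_big/=; apply: eq_bigr => i _; apply: eq_bigr => j _; ring.
  transitivity (r^-1 * T + r^-1 * \sum_i \sum_j x (inl (j, i)) * (g i * g j)).
    rewrite /T !mulr_sumr -big_split; apply: eq_bigr => i _.
    rewrite !mulr_sumr -big_split; apply: eq_bigr => j _ /=; rewrite /Mof; ring.
  by rewrite h; ring.
have e1 : \sum_i \sum_j (Mof x i j - lam * (g i / s) * (g j / s)) ^+ 2 =
    \sum_i \sum_j Mof x i j ^+ 2 - 2 * lam / D * (2 / r * T) + lam ^+ 2 / D ^+ 2 * V.
  rewrite -MT /V !mulr_sumr -sumrB -big_split; apply: eq_bigr => i _ /=.
  rewrite !mulr_sumr -sumrB -big_split; apply: eq_bigr => j _ /=.
  by rewrite -s2; field.
have e2 : \sum_i (bof x i - Num.sqrt tau0 * (g i / s)) ^+ 2 =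
    \sum_i bof x i ^+ 2 - 2 * be1 / D * X + tau0 / D * G.
  rewrite /X /G !mulr_sumr -sumrB -big_split; apply: eq_bigr => i _ /=.
  by rewrite -/be1 -be1_2 -s2 /bof; field.
have e3 : \sum_i \sum_j (al * g i * g j * x (inl (i, j)) - (al * g i * g j) ^+ 2 / 2) =
    al * T - al ^+ 2 / 2 * V.
  rewrite /T /V !mulr_sumr -sumrB; apply: eq_bigr => i _.
  rewrite !mulr_sumr -sumrB; apply: eq_bigr => j _; ring.
have e4 : \sum_l (be1 * g l * x (inr l) - (be1 * g l) ^+ 2 / 2) = be1 * X - tau0 / 2 * G.
  rewrite /X /G !mulr_sumr -sumrB; apply: eq_bigr => i _; rewrite -be1_2; ring.
have e5 : \sum_j (sg0 j g * x j - sg0 j g ^+ 2 / 2) =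
    \sum_i \sum_j (al * g i * g j * x (inl (i, j)) - (al * g i * g j) ^+ 2 / 2) +
    \sum_l (be1 * g l * x (inr l) - (be1 * g l) ^+ 2 / 2).
  rewrite big_sumType/=; congr (_ + _); rewrite pair_bigA/=.
  by apply: eq_bigr => -[k l] _.
have aux (D1 r1 be t A B T1 V1 X1 G1 : R) : D1 != 0 -> r1 != 0 ->
    - (D1 / 4) * (A - 2 * lam / D1 * (2 / r1 * T1) + lam ^+ 2 / D1 ^+ 2 * V1) -
      D1 / 2 * (B - 2 * be / D1 * X1 + t / D1 * G1) =
    - (D1 / 4) * A - D1 / 2 * B +
      (lam / r1 * T1 - lam ^+ 2 / (2 * D1) / 2 * V1 + (be * X1 - t / 2 * G1)).
  by move=> ? ?; field; apply/andP.
by rewrite e1 e2 e5 e3 e4 al2 alE; exact: aux.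
Qed.

Let C_gt0 x : 0 < C x. Proof. exact: expR_gt0. Qed.

Lemma gauss_exp_lik (x : J0 -> R) (p : Th -> R) : moments prior p -> (forall w, 0 <= p w) ->
  gauss_exp (fun g : 'I_d -> R => (p g * lik lam tau0 (Mof x) (bof x) (fun i => g i / s))%:E) =
  (C x * upost prior sg0 p x)%:E.
Proof.
move=> mp p0; have mcp := momentsZ (C x) mp.
rewrite (@eq_gauss_exp _ _ _ (fun g : Th => (C x * p g * lik_ratio sg0 x g)%:E)); last first.
  by move=> g; rewrite likE; congr EFin; ring.
rewrite gauss_expE.
- by rewrite (EFin_upost ms0 _ mcp) (upostZ ms0).
- by apply/measurable_EFinP; exact: moments_measurable (moments_lik_ratio ms0 x mcp).
- by move=> w; rewrite lee_fin !mulr_ge0 ?lik_ratio_ge0// ltW.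
Qed.

Lemma post_overlapE (x : J0 -> R) (v : 'I_d -> R) :
  post_overlap lam tau0 (Mof x) (bof x) v =
  post prior sg0 (fun w => (\sum_i v i * w i) ^+ 2) x / D.
Proof.
have mD2 : moments prior (fun w => (\sum_i v i * w i) ^+ 2).
  by apply: momentsX; apply: moments_sum => i; exact: momentsZ.
have mq : moments prior (fun w => D^-1 * (\sum_i v i * w i) ^+ 2) by exact: momentsZ.
rewrite /post_overlap -/s.
rewrite (@eq_gauss_exp _ _ _ (fun g : 'I_d -> R => (D^-1 * (\sum_i v i * g i) ^+ 2 *
    lik lam tau0 (Mof x) (bof x) (fun i => g i / s))%:E)); last first.
  move=> g; congr (_ * _)%:E; rewrite /dotp -s2 -exprVn -exprMn; congr (_ ^+ 2).
  by rewrite mulr_sumr; apply: eq_bigr => i _; ring.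
rewrite gauss_exp_lik//; last by move=> w; rewrite mulr_ge0 ?sqr_ge0// invr_ge0 ltW.
rewrite [X in _ / fine X](@eq_gauss_exp _ _ _ (fun g : 'I_d -> R => (1 *
    lik lam tau0 (Mof x) (bof x) (fun i => g i / s))%:E)); last by move=> g; rewrite mul1r.
rewrite (gauss_exp_lik x (moments_cst prior 1))//= (upostZ ms0)// /post.
rewrite -/(evidence prior sg0 x); have := evidence_gt0 ms0 x.
have := C_gt0 x; move: (C x) (evidence _ _ _) => c z c0 z0.
by field; rewrite D_neq0 !gt_eqF.
Qed.

(** The right-hand side of [one_step] divided by [D] and the evidence. It takes extended values
    because the integral is shown to be finite only on average over [x]. *)
Definition overlap_bound (x : J0 -> R) : \bar R :=
  (((D * evidence prior sg0 x)^-1)%:E *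
    \int[prior]_k (upost_sqr al be1 be2 (sumf x k))%:E + ((D * delta)^-1)%:E)%E.

Let I_ge0 x : (0 <= \int[prior]_k (upost_sqr al be1 be2 (sumf x k))%:E)%E.
Proof. by apply: integral_ge0 => k _; rewrite lee_fin upost_sqr_ge0. Qed.

Let DZ_gt0 x : 0 < D * evidence prior sg0 x.
Proof. by rewrite mulr_gt0// (evidence_gt0 ms0). Qed.

Lemma overlap_bound_ge0 x : (0 <= overlap_bound x)%E.
Proof.
rewrite /overlap_bound; apply: adde_ge0; last first.
  by rewrite lee_fin invr_ge0 ltW// mulr_gt0.
by apply: mule_ge0 => //; rewrite lee_fin invr_ge0 ltW.
Qed.

Lemma post_overlap_le (x : J0 -> R) v : @unit_sphere R d v ->
  ((post_overlap lam tau0 (Mof x) (bof x) v)%:E <= overlap_bound x)%E.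
Proof.
move=> v1; have := one_step al be1 be2_neq0 x v1.
rewrite post_overlapE /overlap_bound /post -/sg0.
have := DZ_gt0 x; have := evidence_gt0 ms0 x; set Z := evidence _ _ _ => Z0 DZ0.
have := I_ge0 x; case: (integral _ _ _) => [i| |]//= _.
- rewrite be2_2 -EFinD lee_fin => h; rewrite -EFinM -EFinD lee_fin.
  have -> : (D * Z)^-1 * i + (D * delta)^-1 = (i + Z / delta) / Z / D.
    by field; rewrite D_neq0 !gt_eqF.
  by rewrite ler_pM2r ?invr_gt0// ler_pM2r ?invr_gt0.
- move=> _; rewrite gt0_muley; first by rewrite addye ?leey.
  by rewrite lte_fin invr_gt0.
Qed.

Lemma unit_sphere_neq0 : @unit_sphere R d !=set0.
Proof.
pose i0 : 'I_d := Ordinal d_gt0.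
exists (fun i => (i == i0)%:R); rewrite /unit_sphere/= /sqnorm.
rewrite (bigD1 i0)// big1 ?eqxx ?expr1n/= ?addr0// => i /negbTE ->.
by rewrite expr0n.
Qed.

Lemma post_overlap_ge0 x v : 0 <= post_overlap lam tau0 (Mof x) (bof x) v.
Proof.
rewrite post_overlapE; apply: divr_ge0; last exact: ltW.
by apply: post_ge0 => // w; exact: sqr_ge0.
Qed.

Lemma best_overlap_ge0 x : 0 <= best_overlap lam tau0 (Mof x) (bof x).
Proof.
rewrite /best_overlap; set S := [set _ | _ in _].
(* By default [sup] is 0 on a set without supremum, so nonnegativity holds in that case too. *)
have [hS|hS] := pselect (has_sup S); last by rewrite sup_out.
have [v v1] := unit_sphere_neq0.
apply: (@le_trans _ _ (post_overlap lam tau0 (Mof x) (bof x) v)).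
  exact: post_overlap_ge0.
by apply: ub_le_sup; [case: hS|exists v].
Qed.

Lemma best_overlap_le x :
  ((best_overlap lam tau0 (Mof x) (bof x))%:E <= overlap_bound x)%E.
Proof.
have h v := @post_overlap_le x v; have := overlap_bound_ge0 x.
move: (overlap_bound x) h => [b| |]// h _; last by rewrite leey.
rewrite lee_fin; apply: ge_sup.
  by have [v v1] := unit_sphere_neq0; exists (post_overlap lam tau0 (Mof x) (bof x) v); exists v.
by move=> _ [v v1 <-]; have := h v v1; rewrite lee_fin.
Qed.

End reduction.

(** The model draws the matrix, the signal and the vector noise in this order, whereas the channel
    separates the signal from all the noise; Tonelli exchanges the blocks [A] and [B]. *)
Lemma gauss_exp_reindex (R : realType) (A B C : finType)
    (F : gsp B R * gsp (A + C)%type R -> \bar R) :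
  measurable_fun setT F -> (forall q, (0 <= F q)%E) ->
  gauss_exp (fun x : A + B + C -> R =>
    F (fun i => x (inl (inr i)), sumf (fun i => x (inl (inl i))) (fun i => x (inr i)))) =
  (\int[gP R (enum B) \x gP R (enum {: A + C})]_q F q)%E.
Proof.
move=> mF F0.
set f := (fun x : gsp (A + B + C)%type R => _).
have mf : measurable_fun setT f.
  apply: (measurableT_comp mF); apply: measurable_fun_pair.
    by apply: measurable_gsp => i; exact: measurable_coord.
  by apply: measurable_sumf; apply: measurable_gsp => i; exact: measurable_coord.
have f0 x : (0 <= f x)%E by exact: F0.
pose K (p : gsp A R * gsp B R) : \bar R :=
  (\int[gP R (enum C)]_c F (p.2, sumf p.1 c))%E.
have mFs : measurable_fun setT
    (fun q : (gsp A R * gsp B R) * gsp C R => F (q.1.2, sumf q.1.1 q.2)).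
  apply: (measurableT_comp mF); apply: measurable_fun_pair.
    exact: measurableT_comp measurable_snd measurable_fst.
  apply: measurable_sumf; last exact: measurable_snd.
  exact: measurableT_comp measurable_fst measurable_fst.
have mK : measurable_fun setT K.
  exact: (measurable_fun_fubini_tonelli_F
    (fun q : (gsp A R * gsp B R) * gsp C R => F (q.1.2, sumf q.1.1 q.2))).
have K0 p : (0 <= K p)%E by exact: integral_ge0.
have mKs : measurable_fun setT (fun w : gsp (A + B)%type R =>
    K (fun i => w (inl i), fun i => w (inr i))).
  apply: (measurableT_comp mK); apply: measurable_fun_pair;
  by apply: measurable_gsp => i; exact: measurable_coord.
rewrite (gauss_expE mf f0) (ge0_integral_gP_sum mf f0).
transitivity (\int[gP R (enum {: A + B})]_w K (fun i => w (inl i), fun i => w (inr i)))%E.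
  by apply: eq_integral => w _.
rewrite (ge0_integral_gP_sum mKs (fun w => K0 _)).
transitivity (\int[gP R (enum A)]_a \int[gP R (enum B)]_b K (a, b))%E => //.
rewrite (fubini_tonelli K mK K0) fubini_tonelli1//.
apply: eq_integral => b _; rewrite /fubini_F/= ge0_integral_gP_sum//.
exact: measurableT_comp mF (pair1_measurable b).
Qed.

(** * The law of the observation and the average of the pointwise bound *)

Section marginal.
Context d (T : measurableType d) (R : realType) (P : probability T R).
Variables (J : finType) (a : J -> T -> R).
Hypothesis ma : forall j, moments P (a j).
Notation noise := (gP R (enum J)).

(** Integrating the signal out of Bayes' formula: the evidence is the density of the observation
    with respect to pure noise. *)
Lemma ge0_bayes_marginal (H : gsp J R -> \bar R) :
  measurable_fun setT H -> (forall x, (0 <= H x)%E) ->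
  (\int[P \x noise]_q H (observe a q) = \int[noise]_x (H x * (evidence P a x)%:E))%E.
Proof.
move=> mH H0.
have mH2 : measurable_fun setT (fun q : T * gsp J R => H q.2).
  exact: measurableT_comp mH measurable_snd.
rewrite (ge0_bayes ma mH2 (fun q => H0 q.2)) fubini_tonelli2; last 2 first.
- by apply: emeasurable_funM => //; apply/measurable_EFinP; exact: measurable_lik_pair.
- by move=> q; rewrite mule_ge0// lee_fin lik_ratio_ge0.
apply: eq_integral => x _; rewrite /fubini_G/= ge0_integralZl//.
- congr (_ * _)%E; rewrite -(EFin_upost ma x (moments_cst P 1)).
  by apply: eq_integral => t _; rewrite mul1r.
- apply/measurable_EFinP; apply: (measurable_lik_ratio ma); first exact: measurable_cst.
  exact: measurable_id.
- by move=> t _; rewrite lee_fin lik_ratio_ge0.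
Qed.

Lemma measurable_evidence : measurable_fun setT (evidence P a : gsp J R -> R).
Proof. exact: (measurable_upost ma (moments_cst P 1)). Qed.

Lemma integral_evidence : (\int[noise]_x (evidence P a x)%:E = 1)%E.
Proof.
have := @ge0_bayes_marginal (fun=> 1%E) (measurable_cst _) (fun=> lee01).
rewrite (integral_cst_probability (P \x noise)%E) => h; rewrite h.
by apply: eq_integral => x _; rewrite mul1e.
Qed.

End marginal.

Section integrated_bound.
Variables (R : realType) (d : nat) (al be1 be2 : R).
Notation J0 := ('I_d * 'I_d + 'I_d)%type.
Notation J := ('I_d * 'I_d + 'I_d + 'I_d)%type.
Notation prior := (gP R (enum 'I_d)).
Notation Th := (gsp 'I_d R).
Notation sg := (sig al be1 be2).
Let sig0 (j : J0) (w : Th) : R := sg (inl j) w.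

Let mg (i : 'I_d) : moments prior (fun w => w i). Proof. exact: moments_coord. Qed.
Let ms j : moments prior (sg j). Proof. exact: moments_sig. Qed.
Let ms0 j : moments prior (sig0 j). Proof. exact: ms. Qed.
Let U (x : J0 -> R) := (\int[prior]_k (upost_sqr al be1 be2 (sumf x k))%:E)%E.

(** The evidence contained in [upost_sqr] is the density of the observation, so an integral against
    pure noise becomes an expectation under the true law. *)
Lemma integral_upost_sqr :
  (\int[gP R (enum {: J})]_x (upost_sqr al be1 be2 x)%:E = (ovl d al be1 be2)%:E)%E.
Proof.
pose p (x : gsp J R) := \sum_i post prior sg (fun w => w i) x ^+ 2.
have mp : measurable_fun setT (fun x => (p x)%:E).
  apply/measurable_EFinP; apply: measurable_sum => i; apply: measurable_funX.
  exact: measurable_post ms _ _.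
have p0 x : (0 <= (p x)%:E)%E.
  by rewrite lee_fin; apply: sumr_ge0 => i _; exact: sqr_ge0.
have e : (\int[prior \x gP R (enum {: J})]_q (p (observe sg q))%:E = (ovl d al be1 be2)%:E)%E.
  rewrite EFin_Rintegral_moments//.
  by apply: moments_sum => i; apply: momentsX; exact: (moments_post ms (mg i)).
rewrite -e (ge0_bayes_marginal ms mp p0); apply: eq_integral => x _; rewrite -EFinM; congr EFin.
rewrite /p mulr_suml /upost_sqr; apply: eq_bigr => i _; rewrite /post.
by have := evidence_gt0 ms x; move: (evidence _ _ _) => z z0; field; rewrite gt_eqF.
Qed.

Let mF : measurable_fun setT
  (fun q : gsp J0 R * Th => (upost_sqr al be1 be2 (sumf q.1 q.2))%:E).
Proof.
apply/measurable_EFinP; apply: (measurableT_comp (measurable_upost_sqr al be1 be2)).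
by apply: measurable_sumf; [exact: measurable_fst|exact: measurable_snd].
Qed.

Let mU : measurable_fun setT (U : gsp J0 R -> \bar R).
Proof.
apply: (measurable_fun_fubini_tonelli_F
  (fun q : gsp J0 R * Th => (upost_sqr al be1 be2 (sumf q.1 q.2))%:E)) => //.
by move=> q; rewrite lee_fin upost_sqr_ge0.
Qed.

Let U0 x : (0 <= U x)%E.
Proof. by apply: integral_ge0 => k _; rewrite lee_fin upost_sqr_ge0. Qed.

Let intU : (\int[gP R (enum {: J0})]_x U x = (ovl d al be1 be2)%:E)%E.
Proof.
rewrite -integral_upost_sqr
  (@ge0_integral_gP_sum R _ _ (fun x => (upost_sqr al be1 be2 x)%:E))//.
  by apply/measurable_EFinP; exact: measurable_upost_sqr.
by move=> x; rewrite lee_fin upost_sqr_ge0.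
Qed.

(** The shape of [overlap_bound], with [c] standing for [d] and [e] for [1 / (d delta)]. *)
Let H (c e : R) x := (((c * evidence prior sig0 x)^-1)%:E * U x + e%:E)%E.

Lemma measurable_step_bound c e : 0 < c -> measurable_fun setT (H c e : gsp J0 R -> \bar R).
Proof.
move=> c0; apply: emeasurable_funD => //; apply: emeasurable_funM => //.
apply/measurable_EFinP.
rewrite (_ : (fun x : gsp J0 R => _) = (fun x => expR (- ln (c * evidence prior sig0 x)))).
  apply: measurableT_comp => //; apply: measurableT_comp => //.
  apply: measurableT_comp => //; apply: measurable_funM => //.
  exact: measurable_evidence.
by apply/funext => x; rewrite expRN lnK// posrE mulr_gt0// (evidence_gt0 ms0).
Qed.

(** The density of the observation cancels the inverse evidence in [H] and leaves the integral of
    [U], while the constant [e] is averaged by a probability density. *)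
Lemma integral_step_bound c e : 0 < c -> 0 <= e ->
  (\int[prior \x gP R (enum {: J0})]_q H c e (observe sig0 q) =
    (c^-1 * ovl d al be1 be2 + e)%:E)%E.
Proof.
move=> c0 e0; have Z0 x := evidence_gt0 ms0 x.
have H0 x : (0 <= H c e x)%E.
  rewrite /H adde_ge0//; apply: mule_ge0 => //.
  by rewrite lee_fin invr_ge0 ltW// mulr_gt0.
rewrite (ge0_bayes_marginal ms0 (measurable_step_bound e c0) H0).
transitivity (\int[gP R (enum {: J0})]_x
    ((c^-1)%:E * U x + e%:E * (evidence prior sig0 x)%:E))%E.
  apply: eq_integral => x _; rewrite /H muleDl//; last first.
    apply: ge0_adde_def; rewrite inE//; apply: mule_ge0 => //.
    by rewrite lee_fin invr_ge0 ltW// mulr_gt0.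
  congr (_ + _)%E; rewrite muleAC -EFinM; congr (_%:E * _)%E.
  by move: (Z0 x) => z0; field; rewrite !gt_eqF.
have mZ := measurable_evidence ms0.
rewrite ge0_integralD//; last 4 first.
- by move=> x _; rewrite mule_ge0// lee_fin invr_ge0 ltW.
- exact: emeasurable_funM.
- by move=> x _; rewrite mule_ge0// lee_fin ltW.
- by apply: emeasurable_funM => //; exact/measurable_EFinP.
rewrite ge0_integralZl//; last by rewrite lee_fin invr_ge0 ltW.
rewrite ge0_integralZl//; last 2 first.
- exact/measurable_EFinP.
- by move=> x _; rewrite lee_fin ltW.
by rewrite intU (integral_evidence ms0) mule1 -EFinM -EFinD.
Qed.

End integrated_bound.

(** The pair (M, b) is a function of the output of the channel without the extra observation, so the
    pointwise bound can be averaged over that channel. *)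
Lemma ovlap_le (R : realType) (lam tau0 delta : R) (d : nat)
    (al := lam * Num.sqrt (2 * d%:R) / (2 * d%:R)) :
  (0 < d)%N -> 0 <= tau0 -> 0 < delta ->
  (ovlap lam tau0 d <=
    (d%:R^-1 * ovl d al (Num.sqrt tau0) (Num.sqrt delta) + (d%:R * delta)^-1)%:E)%E.
Proof.
move=> d_gt0 tau0_ge0 delta_gt0.
have D0 : 0 < d%:R :> R by rewrite ltr0n.
pose be1 := Num.sqrt tau0; pose be2 := Num.sqrt delta.
pose sg0 (j : 'I_d * 'I_d + 'I_d) (w : gsp 'I_d R) : R := sig al be1 be2 (inl j) w.
pose F q := overlap_bound lam tau0 delta (observe sg0 q).
have mF : measurable_fun setT F.
  apply: measurableT_comp; last first.
    by apply: measurable_observe => j; exact: moments_sig.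
  exact: measurable_step_bound.
have F0 q : (0 <= F q)%E by exact: overlap_bound_ge0.
have -> : (d%:R^-1 * ovl d al be1 be2 + (d%:R * delta)^-1)%:E =
    (\int[gP R (enum 'I_d) \x gP R (enum {: 'I_d * 'I_d + 'I_d})]_q F q)%E.
  by rewrite /F -integral_step_bound// invr_ge0 ltW// mulr_gt0.
pose e (x : 'I_d * 'I_d + 'I_d + 'I_d -> R) :
    gsp 'I_d R * gsp ('I_d * 'I_d + 'I_d)%type R :=
  (fun i => x (inl (inr i)), sumf (fun i => x (inl (inl i))) (fun i => x (inr i))).
rewrite -(gauss_exp_reindex mF F0 : gauss_exp (fun x => F (e x)) = _).
have ME x :
    (fun i j => lam * (x (inl (inr i)) / Num.sqrt d%:R) * (x (inl (inr j)) / Num.sqrt d%:R) +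
      (x (inl (inl (i, j))) + x (inl (inl (j, i)))) / Num.sqrt (2 * d%:R)) =
    Mof (observe sg0 (e x)) /\
    (fun i => Num.sqrt tau0 * (x (inl (inr i)) / Num.sqrt d%:R) + x (inr i) / Num.sqrt d%:R) =
    bof (observe sg0 (e x)).
  have s2 : Num.sqrt (d%:R : R) ^+ 2 = d%:R by rewrite sqr_sqrtr// ltW.
  have r2 : Num.sqrt (2 * d%:R : R) ^+ 2 = 2 * d%:R by rewrite sqr_sqrtr// mulr_ge0// ltW.
  have s0 : Num.sqrt (d%:R : R) != 0 by rewrite gt_eqF// sqrtr_gt0.
  have r0 : Num.sqrt (2 * d%:R : R) != 0 by rewrite gt_eqF// sqrtr_gt0 mulr_gt0.
  split; apply/funext => i; last first.
    by rewrite /bof /observe/= /sg0/= -/be1; field.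
  apply/funext => j; rewrite /Mof /observe/= /sg0/=.
  have aux (g h a b s r D : R) : s != 0 -> r != 0 -> D != 0 -> s ^+ 2 = D -> r ^+ 2 = 2 * D ->
      lam * (g / s) * (h / s) + (a + b) / r =
      (a + lam * r / (2 * D) * g * h + (b + lam * r / (2 * D) * h * g)) / r.
    by move=> s1 r1 D1 <- _; field; apply/andP.
  by apply: aux => //; rewrite gt_eqF.
have -> : ovlap lam tau0 d = gauss_exp (fun x =>
    (best_overlap lam tau0 (Mof (observe sg0 (e x))) (bof (observe sg0 (e x))))%:E).
  by rewrite /ovlap; apply: eq_gauss_exp => x; have [<- <-] := ME x.
have h0 x : (0 <= (best_overlap lam tau0 (Mof (observe sg0 (e x))) (bof (observe sg0 (e x))))%:E)%E.
  have := @best_overlap_ge0 R lam tau0 delta d d_gt0 tau0_ge0 (observe sg0 (e x)).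
  by rewrite lee_fin.
have h1 x : ((best_overlap lam tau0 (Mof (observe sg0 (e x))) (bof (observe sg0 (e x))))%:E <=
    F (e x))%E.
  have := @best_overlap_le R lam tau0 delta d d_gt0 tau0_ge0 delta_gt0 (observe sg0 (e x)).
  by rewrite /F.
exact (le_gauss_exp h0 h1).
Qed.

(** * The threshold *)

Lemma limn_esup_le (R : realType) (u : (\bar R)^nat) (l : \bar R) :
  (\forall n \near \oo, (u n <= l)%E) -> (limn_esup u <= l)%E.
Proof.
move=> [N _ uN]; rewrite limn_esup_lim; apply: lime_le; first exact: is_cvg_esups.
exists N => // n /= Nn; apply: ge_ereal_sup => _ [m /= nm <-].
by apply: uN; exact: leq_trans nm.
Qed.

(** [k] is the value of the quadratic at [T]. Since [lam ^+ 2 * T = lam ^+ 2 - 1 + lam * a], its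
    value at [q] minus [k] factors as [(q - T) * (lam ^+ 2 * q + lam * a + a ^+ 2)], so beyond [T]
    it is at least [k] and exceeds [e]. *)
Lemma quadratic_threshold (R : realFieldType) (lam a k e q : R) (T := 1 - 1 / lam ^+ 2 + a / lam) :
  1 < lam -> 0 < a -> 0 <= q <= 1 ->
  k = T * (lam * a + a ^+ 2) - a ^+ 2 -> e < k ->
  lam ^+ 2 * q ^+ 2 - (lam ^+ 2 - 1 - a ^+ 2) * q - a ^+ 2 <= e ->
  q <= T.
Proof.
move=> l1 a0 /andP[q0 q1] kE ek Pq; rewrite leNgt; apply/negP => Tq.
have l0 : lam != 0 by rewrite gt_eqF// (lt_trans _ l1).
have TE : lam ^+ 2 * T = lam ^+ 2 - 1 + lam * a by rewrite /T; field.
have PT : lam ^+ 2 * T ^+ 2 - (lam ^+ 2 - 1 - a ^+ 2) * T - a ^+ 2 = k.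
  by rewrite kE; ring: TE.
have : 0 <= (q - T) * (lam ^+ 2 * q + lam * a + a ^+ 2).
  apply: mulr_ge0; first by rewrite subr_ge0 ltW.
  have lam0 : 0 <= lam by rewrite ltW// (lt_trans _ l1).
  by rewrite addr_ge0 ?sqr_ge0// addr_ge0// mulr_ge0 ?sqr_ge0// ltW.
have -> : (q - T) * (lam ^+ 2 * q + lam * a + a ^+ 2) =
   lam ^+ 2 * q ^+ 2 - (lam ^+ 2 - 1 - a ^+ 2) * q - a ^+ 2 - k.
  by rewrite -PT; ring: TE.
lra.
Qed.

Theorem theorem4 (R : realType) (lam tau0 : R)
  (hlam : 1 < lam <= 2) (htau : 0 < tau0 <= (lam - 1) ^+ 2) :
  (limn_esup (fun d : nat => ovlap lam tau0 d)
    <= (1 - 1 / lam ^+ 2 + tau0 + Num.sqrt tau0 / lam)%:E)%E.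
Proof.
have /andP[l1 _] := hlam; have /andP[t0 _] := htau.
have l0 : 0 < lam by rewrite (lt_trans _ l1).
set a := Num.sqrt tau0; have a0 : 0 < a by rewrite sqrtr_gt0.
have a2 : a ^+ 2 = tau0 by rewrite sqr_sqrtr// ltW.
pose T := 1 - 1 / lam ^+ 2 + a / lam.
pose k := T * (lam * a + a ^+ 2) - a ^+ 2.
have k0 : 0 < k.
  (* The summand [a ^+ 2] of [T * lam * a] cancels, and all the remaining ones are positive. *)
  have -> : k = a * ((lam ^+ 2 - 1) / lam + a * (lam ^+ 2 - 1) / lam ^+ 2 + a ^+ 2 / lam).
    by rewrite /k /T; field; rewrite gt_eqF.
  have l2 : 0 < lam ^+ 2 - 1 by rewrite subr_gt0 expr_gt1// ltW.
  rewrite mulr_gt0// addr_gt0 ?divr_gt0 ?exprn_gt0//.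
  by rewrite addr_gt0 ?divr_gt0 ?mulr_gt0 ?exprn_gt0.
(* The margin [k] is spent in quarters: one on [delta], one on [eta] and one on the term of order
   [1 / d], through the lower bound [D2] on [d]. The total [3 / 4 * k] stays below [k]. *)
pose delta := k / 4; pose eta := Num.min 1 (k / (4 * lam ^+ 2)).
have delta0 : 0 < delta by rewrite divr_gt0.
have eta0 : 0 < eta by rewrite lt_min ltr01 divr_gt0// mulr_gt0// exprn_gt0.
have eta1 : eta <= 1 by rewrite ge_min lexx.
have etak : lam ^+ 2 * eta <= k / 4.
  have -> : k / 4 = lam ^+ 2 * (k / (4 * lam ^+ 2)) by field; rewrite gt_eqF.
  by rewrite ler_wpM2l ?sqr_ge0// ge_min lexx orbT.
apply: limn_esup_le; near=> d.
have d0 : (0 < d)%N by near: d; exact: nbhs_infty_gt.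
have D0 : 0 < d%:R :> R by rewrite ltr0n.
have D1 : (delta * tau0)^-1 <= d%:R by near: d; exact: nbhs_infty_ger.
have D2 : 4 * lam ^+ 2 / (2 * eta * k) < d%:R by near: d; exact: nbhs_infty_gtr.
apply: le_trans (ovlap_le lam d0 (ltW t0) delta0) _; rewrite lee_fin -/a.
set al := lam * _ / _; set o := ovl d al a _.
have al2 : 2 * al ^+ 2 = lam ^+ 2 / d%:R.
  have r2 : Num.sqrt (2 * d%:R : R) ^+ 2 = 2 * d%:R by rewrite sqr_sqrtr// mulr_ge0// ltW.
  by rewrite /al expr_div_n exprMn r2; field; rewrite gt_eqF.
have o0 : 0 <= o by exact: ovl_ge0.
have oD : o <= d%:R by exact: ovl_le.
have hq := @ovl_quadratic R d al a (Num.sqrt delta) eta.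
rewrite eta0 eta1 -/o a2 sqr_sqrtr ?(ltW delta0)// al2 in hq.
pose q := d%:R^-1 * o.
have oE : o = d%:R * q by rewrite /q mulVKf// gt_eqF.
have q01 : 0 <= q <= 1.
  by rewrite /q mulr_ge0 ?invr_ge0 ?(ltW D0)//= mulrC ler_pdivrMr// mul1r.
have [q0 q1] := andP q01.
have e1 : (d%:R * delta)^-1 <= tau0.
  rewrite invf_ple ?posrE ?mulr_gt0//; move: D1; rewrite invfM -ler_pdivlMl ?invr_gt0//.
  by rewrite invrK mulrC.
have e2 : lam ^+ 2 / (2 * eta * d%:R) < k / 4.
  move: D2; rewrite ltr_pdivrMr ?mulr_gt0// => D2.
  by rewrite ltr_pdivrMr ?mulr_gt0//; lra.
have hP : lam ^+ 2 * q ^+ 2 - (lam ^+ 2 - 1 - a ^+ 2) * q - a ^+ 2 <=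
    delta * (1 - q) + lam ^+ 2 * eta * q ^+ 2 + lam ^+ 2 / (2 * eta * d%:R).
  have {hq} := hq isT.
  rewrite oE.
  have -> : (tau0 + delta) * (d%:R - d%:R * q) + lam ^+ 2 / d%:R *
      (d%:R * (d%:R * q) - (1 - eta) * (d%:R * q) ^+ 2 + d%:R / (2 * eta)) =
      d%:R * ((tau0 + delta) * (1 - q) + lam ^+ 2 * (q - (1 - eta) * q ^+ 2) +
      lam ^+ 2 / (2 * eta * d%:R)) by field; rewrite !gt_eqF.
  by rewrite ler_pM2l// a2; lra.
have qT : q <= T.
  apply: (@quadratic_threshold _ lam a k (3 / 4 * k) q) => //; first lra.
  apply: le_trans hP _.
  have : delta * (1 - q) <= delta by rewrite ler_piMr ?(ltW delta0)// lerBlDr lerDl.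
  have : lam ^+ 2 * eta * q ^+ 2 <= lam ^+ 2 * eta.
    by rewrite ler_piMr ?expr_le1// mulr_ge0 ?sqr_ge0// ltW.
  by rewrite /delta; lra.
rewrite -/q; have : q + (d%:R * delta)^-1 <= T + tau0 by exact: lerD.
by rewrite /T; lra.
Unshelve. all: by end_near.
Qed.
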